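(* Let $G$ be a group of type $\mathrm{FP}$ and let $1\neq c\in Z(G)$ be a non-trivial central element such that the quotient group $\Gamma=G/\langle c\rangle$ is of type $\mathrm{VFP}$. Then any $\mathbb{Z}\Gamma$-module of type $\mathrm{FP}_\infty$ has a finite type projective resolution over $\mathbb{Z}\Gamma$ that is eventually $2$-periodic. In particular, if $G$ is of type $\mathrm{FL}$ with $n=\operatorname{cd}(G)<\infty$, then the trivial $\mathbb{Z}\Gamma$-module $\mathbb{Z}$ has a finite type free resolution over $\mathbb{Z}\Gamma$ which is $2$-periodic in degrees $\ge n-1$.
   Context: All modules are left modules. A group $G$ is of type $\mathrm{FP}$ (respectively $\mathrm{FL}$) if the trivial $\mathbb{Z}G$-module $\mathbb{Z}$ has a finite length resolution by finitely generated projective (respectively free) $\mathbb{Z}G$-modules; $\operatorname{cd}(G)=\operatorname{pd}_{\mathbb{Z}G}(\mathbb{Z})$. A group $\Gamma$ is of type $\mathrm{VFP}$ if it has a torsion-free subgroup of finite index and every finite index torsion-free subgroup is of type $\mathrm{FP}$. A module is of type $\mathrm{FP}_\infty$ if it has a projective resolution by finitely generated projective modules; such a resolution (finitely generated in each degree) is called finite type. A resolution $(M_j,\partial_j:M_j\to M_{j-1})_{j\ge 0}$ is $2$-periodic in degrees $\ge m$ if $M_{j+2}=M_j$ for all $j\ge m$ and $\partial_{j+2}=\partial_j$ for all $j\ge m+1$; it is eventually $2$-periodic if this holds for some $m$. *)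

(* Defs.v *)
From HB Require Import structures.
From mathcomp Require Import all_boot all_algebra.
From mathcomp Require Import finmap monalg boolp.

Set Implicit Arguments.
Unset Strict Implicit.
Unset Printing Implicit Defensive.

Import GRing.Theory.
Local Open Scope ring_scope.
Local Open Scope quotient_scope.

Definition subg_of (G : groupType) (H : groupClosed G) : Type :=
  {x : G | x \in H}.

HB.instance Definition _ (G : groupType) (H : groupClosed G) :=
  SubChoice.on (subg_of H).

Section SubgroupType.
Variables (G : groupType) (H : groupClosed G).

Fact subg_of_group_closed : group_closed (fun x : G => x \in H).
Proof. by split=> [|x y xH yH]; [exact: gpred1 | exact: gpredF]. Qed.

HB.instance Definition _ :=
  SubChoice_isSubGroup.Build G (fun x : G => x \in H) (subg_of H)
    subg_of_group_closed.

End SubgroupType.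

Record normal_subgroup (G : groupType) := NormalSubgroup {
  nsubg :> groupClosed G;
  nsubg_conj : forall x g : G, x \in nsubg -> conjg x g \in nsubg
}.

Section QuotientGroup.
Variables (G : groupType) (N : normal_subgroup G).
Implicit Types x y z : G.

Definition coset_rel x y : bool := (x^-1 * y)%g \in N.

Fact coset_rel_refl : reflexive coset_rel.
Proof. by move=> x; rewrite /coset_rel mulVg gpred1. Qed.

Fact coset_rel_sym : symmetric coset_rel.
Proof.
by move=> x y; rewrite /coset_rel -[(y^-1 * x)%g]invgK invgM invgK gpredV.
Qed.

Fact coset_rel_trans : transitive coset_rel.
Proof.
move=> y x z xy yz; rewrite /coset_rel.
have -> : (x^-1 * z = (x^-1 * y) * (y^-1 * z))%g by rewrite mulgA mulgK.
exact: gpredM.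
Qed.

Canonical coset_equiv :=
  EquivRel coset_rel coset_rel_refl coset_rel_sym coset_rel_trans.

Definition quotg : Type := {eq_quot coset_equiv}.
HB.instance Definition _ := Choice.on quotg.
HB.instance Definition _ := Quotient.on quotg.
HB.instance Definition _ := EqQuotient.on quotg.

Fact coset_eqP x y : \pi_quotg x = \pi_quotg y <-> (x^-1 * y)%g \in N.
Proof. by rewrite (rwP eqP) eqmodE. Qed.

Fact quotgP (u : quotg) : exists x, u = \pi_quotg x.
Proof. by exists (repr u); rewrite reprK. Qed.

Definition quotg_one : quotg := \pi_quotg 1%g.
Definition quotg_mul (u v : quotg) : quotg := \pi_quotg (repr u * repr v)%g.
Definition quotg_inv (u : quotg) : quotg := \pi_quotg (repr u)^-1%g.

Fact pi_quotg_mul x y :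
  quotg_mul (\pi_quotg x) (\pi_quotg y) = \pi_quotg (x * y)%g.
Proof.
apply/coset_eqP; set x' := repr _; set y' := repr _.
have xx' : (x'^-1 * x)%g \in N by apply/coset_eqP; rewrite reprK.
have yy' : (y'^-1 * y)%g \in N by apply/coset_eqP; rewrite reprK.
have -> : ((x' * y')^-1 * (x * y) = conjg (x'^-1 * x) y' * (y'^-1 * y))%g.
  by rewrite /conjg invgM !mulgA mulgK.
exact/gpredM/yy'/nsubg_conj.
Qed.

Fact pi_quotg_inv x : quotg_inv (\pi_quotg x) = \pi_quotg x^-1%g.
Proof.
apply/coset_eqP; set x' := repr _.
have xx' : (x^-1 * x')%g \in N by apply/coset_eqP; rewrite reprK.
have -> : ((x'^-1)^-1 * x^-1 = conjg (x^-1 * x') x^-1)%g.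
  by rewrite /conjg !invgK !mulgA mulgV mul1g.
exact: nsubg_conj.
Qed.

Fact quotg_mulA : associative quotg_mul.
Proof.
move=> u v w; have [x ->] := quotgP u; have [y ->] := quotgP v.
by have [z ->] := quotgP w; rewrite !pi_quotg_mul mulgA.
Qed.

Fact quotg_mul1 : left_id quotg_one quotg_mul.
Proof. by move=> u; have [x ->] := quotgP u; rewrite pi_quotg_mul mul1g. Qed.

Fact quotg_mulr1 : right_id quotg_one quotg_mul.
Proof. by move=> u; have [x ->] := quotgP u; rewrite pi_quotg_mul mulg1. Qed.

Fact quotg_mulV : left_inverse quotg_one quotg_inv quotg_mul.
Proof. by move=> u; have [x ->] := quotgP u; rewrite pi_quotg_inv pi_quotg_mul mulVg. Qed.

Fact quotg_mulrV : right_inverse quotg_one quotg_inv quotg_mul.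
Proof. by move=> u; have [x ->] := quotgP u; rewrite pi_quotg_inv pi_quotg_mul mulgV. Qed.

HB.instance Definition _ := isGroup.Build quotg
  quotg_mulA quotg_mul1 quotg_mulr1 quotg_mulV quotg_mulrV.

End QuotientGroup.

Section CentralCyclic.
Variable G : groupType.
Implicit Types c x g : G.

Definition center : {pred G} := [pred z | `[< forall g, commute z g >]].

Definition cyc c : {pred G} :=
  [pred x | `[< exists n, x = (c ^+ n)%g \/ x = (c ^- n)%g >]].

Fact cycP c x : (x \in cyc c) <-> exists m n, x = (c ^+ m / c ^+ n)%g.
Proof.
split=> [/asboolP[n [->|->]]|[m [n ->]]].
- by exists n, 0; rewrite /= invg1 mulg1.
- by exists 0, n; rewrite /= mul1g.
apply/asboolP; case: (leqP n m) => [le_nm|/ltnW le_mn].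
  by exists (m - n)%N; left; rewrite -{1}(subnK le_nm) expgnDr mulgK.
exists (n - m)%N; right.
by rewrite -{1}(subnK le_mn) expgnDr invgM mulgA mulgV mul1g.
Qed.

Fact cyc_group_closed c : group_closed (cyc c).
Proof.
split=> [|x y /cycP[m [n ->]] /cycP[p [q ->]]]; apply/cycP.
  by exists 0, 0; rewrite /= mulgV.
exists (m + q)%N, (p + n)%N; rewrite !expgnDr !invgM !invgK -!mulgA.
congr (_ * _)%g; rewrite !mulgA; congr (_ * _)%g.
apply: (mulgI (c ^+ n)%g); rewrite !mulgA mulgV mul1g -expgnDr addnC expgnDr.
by rewrite mulgK.
Qed.

HB.instance Definition _ c := isMulClosed.Build G (cyc c)
  (group_closedM (cyc_group_closed c)).
HB.instance Definition _ c := isMul1Closed.Build G (cyc c)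
  (cyc_group_closed c).1.
HB.instance Definition _ c := isInvClosed.Build G (cyc c)
  (group_closedV (cyc_group_closed c)).

Fact cyc_central_conj c (cZ : c \in center) x g :
  x \in cyc c -> conjg x g \in cyc c.
Proof.
move=> xc; suff -> : conjg x g = x by [].
have cg : commute g c by apply: commute_sym; move/asboolP: cZ; apply.
rewrite /conjg; have -> : (x * g = g * x)%g; last by rewrite mulgA mulVg mul1g.
move/asboolP: xc => [n [->|->]]; apply: commute_sym.
  exact: commuteX.
exact/commuteV/commuteX.
Qed.

Definition central_cyc c (cZ : c \in center) : normal_subgroup G :=
  NormalSubgroup (cyc_central_conj cZ).

Definition central_quotient c (cZ : c \in center) : groupType :=
  quotg (central_cyc cZ).

End CentralCyclic.

Arguments center G : clear implicits.

(* [monalg] only gives a ring structure to {malg R[K]} for a conical monoid K,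
   which excludes non-trivial groups; the carrier is reused here. *)
Definition groupring (G : groupType) : Type := {malg int[G]}.

HB.instance Definition _ (G : groupType) := GRing.Zmodule.on (groupring G).

(* G is a phantom argument, recording which group ring acts on [int]. *)
Definition trivial_module (G : groupType) : Type := int.

HB.instance Definition _ (G : groupType) := GRing.Zmodule.on (trivial_module G).

Section GroupRing.
Variable G : groupType.
Implicit Types f g h : groupring G.

Definition gr_one : groupring G := << 1 *g 1%g >>.

Definition gr_mul f g : groupring G :=
  \sum_(x <- msupp f) \sum_(y <- msupp g) << f@_x * g@_y *g (x * y)%g >>.

Fact gr_mulw (d1 d2 : {fset G}) f g :
  (msupp f `<=` d1)%fset -> (msupp g `<=` d2)%fset ->
  gr_mul f g = \sum_(x <- d1) \sum_(y <- d2) << f@_x * g@_y *g (x * y)%g >>.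
Proof.
move=> le1 le2; rewrite /gr_mul (big_fset_incl _ le1) /=.
  apply/eq_bigr=> x _; apply/big_fset_incl => // y _ /mcoeff_outdom ->.
  by rewrite mulr0 monalgU0.
move=> x _ /mcoeff_outdom fx.
by rewrite big1 // => y _; rewrite fx mul0r monalgU0.
Qed.

Fact gr_mul0g : left_zero 0 gr_mul.
Proof. by move=> g; rewrite /gr_mul msupp0 big_seq_fset0. Qed.

Fact gr_mulg0 : right_zero 0 gr_mul.
Proof.
by move=> g; rewrite /gr_mul big1 // => x _; rewrite msupp0 big_seq_fset0.
Qed.

Fact gr_mulUg a x g :
  gr_mul << a *g x >> g = \sum_(y <- msupp g) << a * g@_y *g (x * y)%g >>.
Proof.
rewrite (gr_mulw msuppU_le (fsubset_refl _)) big_seq_fset1.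
by apply/eq_bigr => y _; rewrite mcoeffUU.
Qed.

Fact gr_mulgU a x g :
  gr_mul g << a *g x >> = \sum_(y <- msupp g) << g@_y * a *g (y * x)%g >>.
Proof.
rewrite (gr_mulw (fsubset_refl _) msuppU_le).
by apply/eq_bigr=> y _; rewrite big_seq_fset1 mcoeffUU.
Qed.

Fact gr_mulUU a b x y :
  gr_mul << a *g x >> << b *g y >> = << a * b *g (x * y)%g >>.
Proof.
by rewrite (gr_mulw msuppU_le msuppU_le) !big_seq_fset1 !mcoeffUU.
Qed.

Fact gr_mulgDl : left_distributive gr_mul +%R.
Proof.
move=> f g h.
rewrite (gr_mulw (msuppD_le f g) (fsubset_refl _)).
rewrite (gr_mulw (fsubsetUl _ (msupp g)) (fsubset_refl _)).
rewrite (gr_mulw (fsubsetUr (msupp f) _) (fsubset_refl _)).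
rewrite -big_split /=; apply/eq_bigr=> x _.
rewrite -big_split /=; apply/eq_bigr=> y _.
by rewrite mcoeffD mulrDl monalgUD.
Qed.

Fact gr_mulgDr : right_distributive gr_mul +%R.
Proof.
move=> f g h.
rewrite (gr_mulw (fsubset_refl _) (msuppD_le g h)).
rewrite (gr_mulw (fsubset_refl _) (fsubsetUl _ (msupp h))).
rewrite (gr_mulw (fsubset_refl _) (fsubsetUr (msupp g) _)).
rewrite -big_split /=; apply/eq_bigr=> x _.
rewrite -big_split /=; apply/eq_bigr=> y _.
by rewrite mcoeffD mulrDr monalgUD.
Qed.

Fact gr_mul1g : left_id gr_one gr_mul.
Proof.
move=> g; rewrite gr_mulUg [RHS]monalgE.
by apply/eq_bigr=> x _; rewrite mul1r mul1g.
Qed.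

Fact gr_mulg1 : right_id gr_one gr_mul.
Proof.
move=> g; rewrite gr_mulgU [RHS]monalgE.
by apply/eq_bigr=> x _; rewrite mulr1 mulg1.
Qed.

Fact gr_mulEl f g : gr_mul f g = \sum_(x <- msupp f) gr_mul << f@_x *g x >> g.
Proof. by apply/eq_bigr=> x _; rewrite gr_mulUg. Qed.

Fact gr_mulEr f g : gr_mul f g = \sum_(y <- msupp g) gr_mul f << g@_y *g y >>.
Proof.
rewrite /gr_mul exchange_big; apply/eq_bigr=> y _.
exact/esym/gr_mulgU.
Qed.

Fact gr_mulA : associative gr_mul.
Proof.
move=> f g h.
rewrite [RHS](big_morph (gr_mul^~ _) (fun _ _ => gr_mulgDl _ _ _) (gr_mul0g _)).
rewrite gr_mulEl; apply/eq_bigr=> x _.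
rewrite [LHS](big_morph (gr_mul _) (fun _ _ => gr_mulgDr _ _ _) (gr_mulg0 _)).
rewrite [RHS](big_morph (gr_mul^~ _) (fun _ _ => gr_mulgDl _ _ _) (gr_mul0g _)).
apply/eq_bigr=> y _.
rewrite [LHS](big_morph (gr_mul _) (fun _ _ => gr_mulgDr _ _ _) (gr_mulg0 _)).
by rewrite gr_mulEr; apply/eq_bigr=> z _; rewrite !gr_mulUU mulrA mulgA.
Qed.

Fact gr_one_neq0 : gr_one != 0.
Proof. by apply/eqP/malgP=> /(_ 1%g) /eqP; rewrite mcoeffUU mcoeff0. Qed.

HB.instance Definition _ := GRing.Zmodule_isNzRing.Build (groupring G)
  gr_mulA gr_mul1g gr_mulg1 gr_mulgDl gr_mulgDr gr_one_neq0.

Definition augmentation f : int := \sum_(x <- msupp f) f@_x.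

Fact augmentationw (d : {fset G}) f :
  (msupp f `<=` d)%fset -> augmentation f = \sum_(x <- d) f@_x.
Proof.
by move=> le; apply: (big_fset_incl _ le) => x _ /mcoeff_outdom.
Qed.

Fact augmentationU a x : augmentation << a *g x >> = a.
Proof. by rewrite (augmentationw msuppU_le) big_seq_fset1 mcoeffUU. Qed.

Fact augmentation0 : augmentation 0 = 0.
Proof. by rewrite /augmentation msupp0 big_seq_fset0. Qed.

Fact augmentation1 : augmentation 1 = 1.
Proof. exact: augmentationU. Qed.

Fact augmentationD : {morph augmentation : f g / f + g}.
Proof.
move=> f g; rewrite (augmentationw (msuppD_le f g)).
rewrite (augmentationw (fsubsetUl _ (msupp g))).
rewrite (augmentationw (fsubsetUr (msupp f) _)).
by rewrite -big_split; apply/eq_bigr=> x _; rewrite mcoeffD.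
Qed.

Fact augmentationM : {morph augmentation : f g / f * g}.
Proof.
move=> f g; rewrite [f * g]/(gr_mul f g) /gr_mul.
rewrite (big_morph _ augmentationD augmentation0) mulr_suml.
apply/eq_bigr=> x _; rewrite (big_morph _ augmentationD augmentation0) mulr_sumr.
by apply/eq_bigr=> y _; rewrite augmentationU.
Qed.

Local Notation Ztriv := (trivial_module G).

Definition trivmod_scale f (z : Ztriv) : Ztriv := augmentation f * (z : int).

Fact trivmod_scaleA f g z :
  trivmod_scale f (trivmod_scale g z) = trivmod_scale (f * g) z.
Proof. by rewrite /trivmod_scale augmentationM mulrA. Qed.

Fact trivmod_scale1 : left_id 1 trivmod_scale.
Proof. by move=> z; rewrite /trivmod_scale augmentation1 mul1r. Qed.

Fact trivmod_scaleDr : right_distributive trivmod_scale +%R.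
Proof. by move=> f z z'; rewrite /trivmod_scale -mulrDr. Qed.

Fact trivmod_scaleDl z : {morph trivmod_scale^~ z : f g / f + g}.
Proof. by move=> f g; rewrite /trivmod_scale augmentationD mulrDl. Qed.

HB.instance Definition _ := GRing.Zmodule_isLmodule.Build (groupring G) Ztriv
  trivmod_scaleA trivmod_scale1 trivmod_scaleDr trivmod_scaleDl.

End GroupRing.

Section Modules.
Variable R : nzRingType.
Implicit Types M N P : lmodType R.

Definition zero_module M : Prop := forall x : M, x = 0.

Definition fin_generated M : Prop :=
  exists (n : nat) (e : 'I_n -> M),
    forall x, exists a : 'rV[R]_n, x = \sum_i a 0 i *: e i.

Definition projective P : Prop :=
  forall M N (g : {linear M -> N}) (f : {linear P -> N}),
    (forall y, exists x, g x = y) ->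
    exists h : {linear P -> M}, forall x, g (h x) = f x.

Definition fg_projective M : Prop := fin_generated M /\ projective M.

Definition fg_free M : Prop :=
  exists (n : nat) (e : 'I_n -> M),
    forall x, exists! a : 'rV[R]_n, x = \sum_i a 0 i *: e i.

(* [res_map F j] is the differential from degree j.+1 to degree j. *)
Record resolution M := Resolution {
  res_mod :> nat -> lmodType R;
  res_map : forall j, {linear res_mod j.+1 -> res_mod j};
  res_aug : {linear res_mod 0 -> M};
  res_aug_surj : forall x, exists y, res_aug y = x;
  res_exact0 : forall x, res_aug x = 0 <-> exists y, res_map 0 y = x;
  res_exact : forall j x, res_map j x = 0 <-> exists y, res_map j.+1 y = x
}.

Definition res_all (p : lmodType R -> Prop) M (F : resolution M) : Prop :=
  forall j, p (F j).

Definition res_length_le M (F : resolution M) (n : nat) : Prop :=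
  forall j, (n < j)%N -> zero_module (F j).

(* Packing a homomorphism with its source and target lets one state equality
   of homomorphisms between modules that are only propositionally equal. *)
Record module_map := ModuleMap {
  mm_src : lmodType R;
  mm_tgt : lmodType R;
  mm_map : {linear mm_src -> mm_tgt}
}.

Definition two_periodic_from M (F : resolution M) (m : nat) : Prop :=
  (forall j, (m <= j)%N -> F j.+2 = F j) /\
  (forall j, (m <= j)%N ->
     ModuleMap (res_map F j.+2) = ModuleMap (res_map F j)).

Definition eventually_two_periodic M (F : resolution M) : Prop :=
  exists m, two_periodic_from F m.

Definition type_FPinfty M : Prop :=
  exists F : resolution M, res_all fg_projective F.

Definition pd_le M (n : nat) : Prop :=
  exists F : resolution M, res_all projective F /\ res_length_le F n.

(* Meaningful for M <> 0 only. *)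
Definition pd_eq M (n : nat) : Prop :=
  pd_le M n /\ forall m, pd_le M m -> (n <= m)%N.

End Modules.

Section GroupFiniteness.
Variable G : groupType.

Definition type_FP : Prop :=
  exists (F : resolution (trivial_module G)) (n : nat),
    res_all (@fg_projective _) F /\ res_length_le F n.

Definition type_FL : Prop :=
  exists (F : resolution (trivial_module G)) (n : nat),
    res_all (@fg_free _) F /\ res_length_le F n.

Definition cd_eq (n : nat) : Prop := pd_eq (trivial_module G) n.

Definition torsion_free : Prop :=
  forall (x : G) (n : nat), (0 < n)%N -> (x ^+ n)%g = 1%g -> x = 1%g.

Definition finite_index (H : groupClosed G) : Prop :=
  exists s : seq G, forall x, exists2 y, y \in s & (y^-1 * x)%g \in H.

End GroupFiniteness.

Definition type_VFP (G : groupType) : Prop :=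
  (exists H : groupClosed G, torsion_free (subg_of H) /\ finite_index H) /\
  (forall H : groupClosed G,
     torsion_free (subg_of H) -> finite_index H -> type_FP (subg_of H)).

(* Main.v *)
Require Import Defs.
From HB Require Import structures.
From mathcomp Require Import all_boot all_algebra.
From mathcomp Require Import finmap monalg boolp classical_sets functions.

(** Let R = ZG, S = Z[G/<c>] and x = c - 1, so that S = R/xR.  Tate cohomology
of <c> shows that c has infinite order, whence x is a central non-zero-divisor.

If N is an S-module with a resolution 0 -> P1 -> P0 -> N by projective
R-modules, multiplication by x on P0 factors through P1, and reducing the
resulting matrix factorization modulo x gives a 2-periodic resolution of N over
S (Eisenbud).  Since projective S-modules have dimension at most 1 over R,
passing from an S-module to a syzygy over S lowers its dimension over R by one,
as long as it is at least 2.  It remains to see that a first syzygy N of an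
S-module has finite dimension over R: N is free over Z, and tensoring N over Z
with a projective resolution of the trivial module Z bounds its dimension by
cd G.  In the case FL the same argument is run with stably free modules. *)

Set Implicit Arguments.
Unset Strict Implicit.
Unset Printing Implicit Defensive.

Import GRing.Theory Num.Theory.
Local Open Scope ring_scope.
Local Open Scope quotient_scope.

(** * Modules and exact sequences *)

(** The delicate point is the dimension of a syzygy. No tensor product over Z is formed: linear maps
    out of it are replaced by equivariant biadditive maps, and the bound appears as the vanishing of
    Ext^(n+1)(N, X) for every X. Extending a biadditive map across a boundary requires the boundary
    to split additively. Projective R-modules have in general infinite rank over Z, so this
    splitting is the theorem on subgroups of free abelian groups, in the form of a complement found
    by Zorn's lemma.

    This bound says nothing about finite generation. Dimensions are therefore counted with arbitrary
    projectives, and finite generation is restored at the end from the given finite type resolution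
    over S.

    In the case FL, Z has dimension n over R while a matrix factorization requires dimension 1,
    which leaves n - 1 syzygies. A finite free resolution may be longer than n, and cutting it off
    at n yields only a stably free kernel; adding a free module to both terms of the last short
    resolution makes them free again. *)

Lemma linear_pack (R : nzRingType) (U V : lmodType R) (f : U -> V) :
  linear f -> exists g : {linear U -> V}, forall x, g x = f x.
Proof.
move=> lin_f; pose m := GRing.isLinear.Build R U V *:%R f lin_f.
pose g : {linear U -> V} := HB.pack f m.
by exists g.
Qed.

Section Kernel.
Variables (R : nzRingType) (U V : lmodType R) (f : {linear U -> V}).

Definition ker_pred : {pred U} := [pred x | f x == 0].

Fact ker_submod : submod_closed ker_pred.
Proof.
split=> [|a x y]; rewrite !inE ?linear0 // => /eqP fx /eqP fy.
by rewrite linearP fx fy scaler0 addr0.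
Qed.

HB.instance Definition _ := GRing.isSubmodClosed.Build R U ker_pred ker_submod.

Definition kermod : Type := {x : U | x \in ker_pred}.
HB.instance Definition _ := SubChoice.on kermod.
HB.instance Definition _ := [SubChoice_isSubLmodule of kermod by <:].

Definition ker_incl : {linear kermod -> U} := \val.

Lemma ker_incl_inj : injective ker_incl.
Proof. exact: val_inj. Qed.

Lemma ker_inclP x : f x = 0 <-> exists k, ker_incl k = x.
Proof.
split=> [fx|[k <-]]; last by apply/eqP; exact: (valP k).
have kx : x \in ker_pred by rewrite inE fx.
by exists (exist _ x kx).
Qed.

End Kernel.

Definition onto (T T' : Type) (p : T -> T') : Prop := forall y, exists x, p x = y.

Section ModuleTheory.
Variable R : nzRingType.
Implicit Types F K L M N P Q U V W X : lmodType R.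

Lemma linear_lift U V W (i : {linear V -> W}) (f : {linear U -> W}) :
  injective i -> (forall u, exists v, i v = f u) ->
  exists g : {linear U -> V}, forall u, i (g u) = f u.
Proof.
move=> inj_i /choice[g gP]; have [|h hE] := @linear_pack R U V g.
  by move=> a x y; apply: inj_i; rewrite linearP !gP linearP.
by exists h => u; rewrite hE.
Qed.

Lemma linear_factor U V W (p : {linear U -> V}) (f : {linear U -> W}) :
  onto p -> (forall u, p u = 0 -> f u = 0) ->
  exists g : {linear V -> W}, forall u, g (p u) = f u.
Proof.
move=> /choice[s sP] pf.
have eq_f u u' : p u = p u' -> f u = f u'.
  move=> eq_p; apply/eqP; rewrite -subr_eq0 -linearB.
  by apply/eqP/pf; rewrite linearB eq_p subrr.
have [|h hE] := @linear_pack R V W (fun v => f (s v)).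
  by move=> a x y; rewrite -linearP; apply: eq_f; rewrite linearP !sP.
by exists h => u; rewrite hE; apply: eq_f; rewrite sP.
Qed.

Lemma linear_inj_eq0 U V (i : {linear U -> V}) x :
  injective i -> i x = 0 <-> x = 0.
Proof.
by move=> inj_i; split=> [ix|->]; [apply: inj_i; rewrite ix linear0 | rewrite linear0].
Qed.

Definition ses K P N (i : {linear K -> P}) (p : {linear P -> N}) : Prop :=
  [/\ injective i, onto p & forall x, p x = 0 <-> exists k, i k = x].

Lemma ker_ses P N (p : {linear P -> N}) : onto p -> ses (ker_incl p) p.
Proof. by split; [exact: ker_incl_inj | | exact: ker_inclP]. Qed.

Lemma ses_comp0 K P N (i : {linear K -> P}) (p : {linear P -> N}) k :
  ses i p -> p (i k) = 0.
Proof. by case=> _ _ ex; apply/ex; exists k. Qed.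

Definition iso U V : Prop :=
  exists (f : {linear U -> V}) (g : {linear V -> U}), cancel f g /\ cancel g f.

Lemma iso_bij U V (f : {linear U -> V}) : injective f -> onto f -> iso U V.
Proof.
move=> inj_f surj_f.
have [g gP] := @linear_lift V U V f idfun inj_f surj_f.
by exists f, g; split=> // x; apply: inj_f; rewrite gP.
Qed.

Lemma iso_refl U : iso U U.
Proof. by exists idfun, idfun. Qed.

Lemma iso_sym U V : iso U V -> iso V U.
Proof. by case=> f [g [fK gK]]; exists g, f. Qed.

Lemma iso_trans U V W : iso U V -> iso V W -> iso U W.
Proof.
move=> [f [g [fK gK]]] [f' [g' [f'K g'K]]].
by exists (f' \o f), (g \o g'); split=> x /=; rewrite ?f'K ?fK ?gK ?g'K.
Qed.

Lemma linear_prod U V U' V' (f : {linear U -> U'}) (g : {linear V -> V'}) :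
  exists h : {linear (U * V)%type -> (U' * V')%type},
    forall x, h x = (f x.1, g x.2).
Proof.
by apply: linear_pack => a x y; rewrite !linearP.
Qed.

Lemma linear_pair U V V' (f : {linear U -> V}) (g : {linear U -> V'}) :
  exists h : {linear U -> (V * V')%type}, forall x, h x = (f x, g x).
Proof. by apply: linear_pack => a x y; rewrite !linearP. Qed.

Lemma linear_copair U U' V (f : {linear U -> V}) (g : {linear U' -> V}) :
  exists h : {linear (U * U')%type -> V}, forall x, h x = f x.1 + g x.2.
Proof.
apply: linear_pack => a x y; rewrite !linearP scalerDr !addrA.
by congr (_ + _); rewrite addrAC.
Qed.

Lemma iso_prod U V U' V' : iso U U' -> iso V V' -> iso (U * V)%type (U' * V')%type.
Proof.
move=> [f [g [fK gK]]] [f' [g' [f'K g'K]]].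
have [h hE] := linear_prod f f'; have [k kE] := linear_prod g g'.
by exists h, k; split=> -[x y]; rewrite hE kE /= ?fK ?f'K ?gK ?g'K.
Qed.

Lemma iso_prodC U V : iso (U * V)%type (V * U)%type.
Proof.
have [h hE] := @linear_pack R (U * V)%type (V * U)%type
  (fun x => (x.2, x.1)) (fun a x y => erefl).
have [k kE] := @linear_pack R (V * U)%type (U * V)%type
  (fun x => (x.2, x.1)) (fun a x y => erefl).
by exists h, k; split=> -[x y]; rewrite hE kE.
Qed.

Lemma iso_prodA U V W : iso (U * (V * W))%type (U * V * W)%type.
Proof.
have [h hE] := @linear_pack R (U * (V * W))%type (U * V * W)%type
  (fun x => (x.1, x.2.1, x.2.2)) (fun a x y => erefl).
have [k kE] := @linear_pack R (U * V * W)%type (U * (V * W))%type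
  (fun x => (x.1.1, (x.1.2, x.2))) (fun a x y => erefl).
by exists h, k; split=> [[x [y z]]|[[x y] z]]; rewrite hE kE.
Qed.

Lemma iso_prodACA U V U' V' :
  iso ((U * V) * (U' * V'))%type ((U * U') * (V * V'))%type.
Proof.
apply: iso_trans (iso_sym (iso_prodA _ _ _)) _.
apply: iso_trans _ (iso_prodA _ _ _); apply: iso_prod; first exact: iso_refl.
apply: iso_trans (iso_prodA _ _ _) _.
apply: iso_trans _ (iso_sym (iso_prodA _ _ _)).
by apply: iso_prod; [exact: iso_prodC | exact: iso_refl].
Qed.

Lemma split_iso K P N (i : {linear K -> P}) (p : {linear P -> N})
    (s : {linear N -> P}) :
  ses i p -> cancel s p -> iso P (K * N)%type.
Proof.
move=> ip sK; have [inj_i _ ex] := ip; have [h hE] := linear_copair i s.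
apply/iso_sym/(iso_bij (f := h)).
  move=> [k n] [k' n']; rewrite !hE /= => eq_h.
  have eq_n : n = n'.
    by move/(congr1 p): eq_h; rewrite !linearD !(ses_comp0 _ ip) !add0r !sK.
  by move: eq_h; rewrite eq_n => /addIr/inj_i ->.
move=> x; have /ex[k kE] : p (x - s (p x)) = 0 by rewrite linearB sK subrr.
by exists (k, p x); rewrite hE /= kE subrK.
Qed.

Lemma ses_prod K P N K' P' N' (i : {linear K -> P}) (p : {linear P -> N})
    (i' : {linear K' -> P'}) (p' : {linear P' -> N'}) : ses i p -> ses i' p' ->
  exists (j : {linear (K * K')%type -> (P * P')%type})
    (q : {linear (P * P')%type -> (N * N')%type}), ses j q.
Proof.
move=> [inj_i pS ex] [inj_i' p'S ex'].
have [j jE] := linear_prod i i'; have [q qE] := linear_prod p p'.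
exists j, q; split=> [[a b] [c d]|[y y']|[x x']].
- by rewrite !jE => -[/inj_i -> /inj_i' ->].
- by have [[x <-] [x' <-]] := (pS y, p'S y'); exists (x, x'); rewrite qE.
rewrite qE; split=> [[/ex[k <-] /ex'[k' <-]]|[[k k']]].
  by exists (k, k'); rewrite jE.
rewrite jE => -[<- <-] /=; congr (_, _); first by apply/ex; exists k.
by apply/ex'; exists k'.
Qed.

Lemma ses_isor K P N N' (i : {linear K -> P}) (p : {linear P -> N})
    (f : {linear N -> N'}) :
  injective f -> onto f -> ses i p -> ses i (f \o p).
Proof.
move=> inj_f fS [inj_i pS ex]; split=> // [y|x /=].
  by have [z <-] := fS y; have [x <-] := pS z; exists x.
rewrite -ex; split=> [fpx|->]; last exact: linear0.
by apply: inj_f; rewrite fpx linear0.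
Qed.

(* Third isomorphism theorem: K/L is the kernel M' of F -> M. *)
Lemma ses_compr L Q F M' M K (i : {linear L -> Q}) (p : {linear Q -> F})
    (j : {linear M' -> F}) (q : {linear F -> M}) (k : {linear K -> Q}) :
  ses i p -> ses j q -> ses k (q \o p) ->
  exists (l : {linear L -> K}) (r : {linear K -> M'}), ses l r.
Proof.
move=> [inj_i pS ex] [inj_j qS ex'] [inj_k _ exk].
have [|l lE] := @linear_lift L K Q k i inj_k.
  move=> x; apply/exk => /=; have -> : p (i x) = 0 by apply/ex; exists x.
  exact: linear0.
have [|r rE] := @linear_lift K M' F j (p \o k) inj_j.
  by move=> x; apply/ex'; apply/exk; exists x.
exists l, r; split=> [x y /(congr1 k)|y|x].
- by rewrite !lE => /inj_i.
- have [x xE] := pS (j y); have /exk[z zE] : (q \o p) x = 0.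
    by rewrite /= xE; apply/ex'; exists y.
  by exists z; apply: inj_j; rewrite rE /= zE.
split=> [rx|[y <-]].
  have /ex[y yE] : p (k x) = 0 by have := rE x; rewrite rx linear0.
  by exists y; apply: inj_k; rewrite lE.
apply: inj_j; rewrite rE /= lE linear0; apply/ex.
by exists y.
Qed.

Lemma ses_fst U V : exists (i : {linear V -> (U * V)%type})
  (p : {linear (U * V)%type -> U}), ses i p /\ forall x, p x = x.1.
Proof.
have [p pE] := @linear_pack R (U * V)%type U (fun x => x.1) (fun a x y => erefl).
have [|i iE] := @linear_pack R V (U * V)%type (fun x => (0, x)).
  by move=> a x y; congr (_, _); rewrite /= scaler0 addr0.
exists i, p; split=> //; split=> [x y|y|x].
- by rewrite !iE => -[].
- by exists (y, 0); rewrite pE.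
rewrite pE; split=> [|[k <-]]; last by rewrite iE.
by case: x => x y /= ->; exists y; rewrite iE.
Qed.

Lemma projective_retract U V (i : {linear U -> V}) (r : {linear V -> U}) :
  cancel i r -> projective V -> projective U.
Proof.
move=> iK pV M N g f gS; have [h hE] := pV M N g (f \o r) gS.
by exists (h \o i) => x; rewrite /= hE /= iK.
Qed.

Lemma projective_iso U V : iso U V -> projective U -> projective V.
Proof. by move=> [f [g [fK gK]]]; apply: projective_retract gK. Qed.

Lemma projective_prod U V :
  projective U -> projective V -> projective (U * V)%type.
Proof.
move=> pU pV M N g f gS.
have [u uE] := @linear_pair U U V idfun \0; have [v vE] := @linear_pair V U V \0 idfun.
have [hu huE] := pU M N g (f \o u) gS; have [hv hvE] := pV M N g (f \o v) gS.
have [h hE] := linear_copair hu hv; exists h => -[x y].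
rewrite hE linearD huE hvE /= uE vE /= -linearD; congr (f _).
by congr (_, _) => /=; rewrite ?addr0 ?add0r.
Qed.

Lemma projective_fst U V : projective (U * V)%type -> projective U.
Proof.
have [u uE] := @linear_pair U U V idfun \0.
have [_ [p [_ pE]]] := ses_fst U V.
by apply: (projective_retract (i := u) (r := p)) => x; rewrite pE uE.
Qed.

(** Since [b \o a] is not assumed to vanish, U is first replaced by its submodule ker (b \o a),
    which [a] maps onto ker b; projectivity applies to this surjection. *)
Lemma projective_lift_exact P U V W (a : {linear U -> V}) (b : {linear V -> W})
    (f : {linear P -> V}) :
  projective P -> (forall y, b y = 0 -> exists x, a x = y) ->
  (forall x, b (f x) = 0) -> exists h : {linear P -> U}, forall x, a (h x) = f x.
Proof.
move=> pP ex bf0.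
have [|a' a'E] := @linear_lift (kermod (b \o a)) (kermod b) V (ker_incl b)
    (a \o ker_incl (b \o a)) (@ker_incl_inj _ _ _ b).
  by move=> u; apply/ker_inclP/(ker_inclP (b \o a)); exists u.
have [|f' f'E] := @linear_lift P (kermod b) V (ker_incl b) f (@ker_incl_inj _ _ _ b).
  by move=> u; apply/ker_inclP.
have [|h hE] := pP _ _ a' f'.
  move=> y; have /ker_inclP by0 : exists k, ker_incl b k = ker_incl b y by exists y.
  have [x xE] := ex _ by0; have /(ker_inclP (b \o a))[z zE] : b (a x) = 0 by rewrite xE.
  by exists z; apply: (@ker_incl_inj _ _ _ b); rewrite a'E -xE -zE.
exists (ker_incl (b \o a) \o h) => x.
by rewrite -f'E -hE a'E.
Qed.

(** No pullback is formed. The lifts h and h' of p and p' through each other give the two mutually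
    inverse maps [F] and [G] by explicit formulas. *)
Lemma schanuel K P K' P' N (i : {linear K -> P}) (p : {linear P -> N})
    (i' : {linear K' -> P'}) (p' : {linear P' -> N}) :
  ses i p -> ses i' p' -> projective P -> projective P' ->
  iso (K * P')%type (K' * P)%type.
Proof.
move=> ip ip' pP pP'; have [inj_i pS ex] := ip; have [inj_i' p'S ex'] := ip'.
have [h hE] := pP P' N p' p p'S; have [h' h'E] := pP' P N p p' pS.
have [a aE] := linear_copair i h'; have [b bE] := linear_copair i' h.
have pa x : p (a x) = p' x.2.
  by rewrite aE linearD (ses_comp0 _ ip) add0r h'E.
have pb x : p' (b x) = p x.2.
  by rewrite bE linearD (ses_comp0 _ ip') add0r hE.
have [p2 p2E] := @linear_pack R (K * P')%type P' (fun x => x.2) (fun a x y => erefl).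
have [q2 q2E] := @linear_pack R (K' * P)%type P (fun x => x.2) (fun a x y => erefl).
have [|f fE] := @linear_lift (K * P')%type K' P' i' (p2 \- (h \o a)) inj_i'.
  by move=> x; apply/ex'; rewrite /= linearB hE p2E pa subrr.
have [|g gE] := @linear_lift (K' * P)%type K P i (q2 \- (h' \o b)) inj_i.
  by move=> x; apply/ex; rewrite /= linearB h'E q2E pb subrr.
have [F FE] := linear_pair f a; have [G GE] := linear_pair g b.
exists F, G; split=> -[k x].
  rewrite FE GE; have bx : b (f (k, x), a (k, x)) = x.
    by rewrite bE /= fE /= p2E subrK.
  congr (_, _) => //; apply: inj_i.
  by rewrite gE /= bx q2E /= aE addrK.
rewrite GE FE; have ax : a (g (k, x), b (k, x)) = x.
  by rewrite aE /= gE /= q2E subrK.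
congr (_, _) => //; apply: inj_i'.
by rewrite fE /= ax p2E /= bE addrK.
Qed.

End ModuleTheory.

(** * Finiteness conditions and resolution dimension *)

Section FinitelyGenerated.
Variable R : nzRingType.
Implicit Types F K L M N P Q U V W X : lmodType R.

Lemma linear_row n M (e : 'I_n -> M) :
  exists f : {linear 'rV[R]_n -> M}, forall a, f a = \sum_i a 0 i *: e i.
Proof.
apply: linear_pack => b x y; rewrite scaler_sumr -big_split /=.
by apply: eq_bigr => i _; rewrite !mxE scalerDl scalerA.
Qed.

Lemma fin_generatedP M :
  fin_generated M <-> exists n (f : {linear 'rV[R]_n -> M}), onto f.
Proof.
split=> [[n [e eP]]|[n [f fS]]].
  have [f fE] := linear_row e; exists n, f => x.
  by have [a ->] := eP x; exists a; rewrite fE.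
exists n, (fun i => f (delta_mx 0 i)) => x; have [a <-] := fS x; exists a.
rewrite [in LHS](row_sum_delta a) linear_sum.
by apply: eq_bigr => i _; rewrite linearZ.
Qed.

Lemma fin_generated_surj M N (p : {linear M -> N}) :
  onto p -> fin_generated M -> fin_generated N.
Proof.
move=> pS /fin_generatedP[n [f fS]]; apply/fin_generatedP.
exists n, (p \o f) => y; have [x <-] := pS y; have [a <-] := fS x.
by exists a.
Qed.

Lemma projective_row n : projective 'rV[R]_n.
Proof.
move=> M N g f gS.
have /choice[e eP] : forall i, exists x, g x = f (delta_mx 0 i) by move=> i; exact: gS.
have [h hE] := linear_row e; exists h => a.
rewrite hE [in RHS](row_sum_delta a) !linear_sum; apply: eq_bigr => i _.
by rewrite !linearZ eP.
Qed.

Lemma iso_row m n : iso ('rV[R]_m * 'rV[R]_n)%type 'rV[R]_(m + n).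
Proof.
have [|f fE] := @linear_pack R ('rV[R]_m * 'rV[R]_n)%type 'rV[R]_(m + n)
    (fun x => row_mx x.1 x.2).
  by move=> a x y; rewrite /= scale_row_mx add_row_mx.
apply: (iso_bij (f := f)) => [[x y] [x' y']|z].
  by rewrite !fE /= => /eq_row_mx[-> ->].
by exists (lsubmx z, rsubmx z); rewrite fE hsubmxK.
Qed.

Lemma fin_generated_ext K P N (i : {linear K -> P}) (p : {linear P -> N}) :
  ses i p -> fin_generated K -> fin_generated N -> fin_generated P.
Proof.
move=> [_ pS ex] /fin_generatedP[m [f fS]] /fin_generatedP[n [g gS]].
have [h hE] := projective_row (g := p) g pS.
have [u uE] := linear_copair (i \o f) h.
apply/fin_generatedP; exists (m + n)%N.
have [w [w' [wK w'K]]] := iso_sym (iso_row m n).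
exists (u \o w) => x; have [b bE] := gS (p x).
have /ex[k kE] : p (x - h b) = 0 by rewrite linearB hE bE subrr.
have [a aE] := fS k; exists (w' (a, b)).
by rewrite /= w'K uE /= aE kE subrK.
Qed.

Lemma fin_generated_fst U V : fin_generated (U * V)%type -> fin_generated U.
Proof.
have [_ [p [[_ pS _] _]]] := ses_fst U V.
exact: fin_generated_surj.
Qed.

Lemma fin_generated_prod U V :
  fin_generated U -> fin_generated V -> fin_generated (U * V)%type.
Proof.
have [i [p [ip _]]] := ses_fst U V => fU fV.
exact: fin_generated_ext ip fV fU.
Qed.

Lemma fin_generated_iso U V : iso U V -> fin_generated U -> fin_generated V.
Proof.
by move=> [f [g [fK gK]]]; apply: (fin_generated_surj (p := f)) => y; exists (g y).
Qed.

Lemma fg_freeP M : fg_free M <-> exists n, iso 'rV[R]_n M.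
Proof.
split=> [[n [e eP]]|[n [f [g [fK gK]]]]].
  have [f fE] := linear_row e; exists n; apply: (iso_bij (f := f)) => [a b|x].
    have [c [_ cU]] := eP (f a) => fab.
    by rewrite -[a]cU ?fE // -[b in RHS]cU // fab fE.
  by have [a [-> _]] := eP x; exists a; rewrite fE.
exists n, (fun i => f (delta_mx 0 i)) => x.
have fE a : f a = \sum_i a 0 i *: f (delta_mx 0 i).
  rewrite [in LHS](row_sum_delta a) linear_sum.
  by apply: eq_bigr => i _; rewrite linearZ.
by exists (g x); split=> [|a]; rewrite -fE ?gK // => ->; rewrite fK.
Qed.

Lemma fg_free_row n : fg_free 'rV[R]_n.
Proof. by apply/fg_freeP; exists n; exact: iso_refl. Qed.

Lemma fg_free_iso U V : iso U V -> fg_free U -> fg_free V.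
Proof.
move=> UV /fg_freeP[n nU]; apply/fg_freeP; exists n; exact: iso_trans nU UV.
Qed.

Lemma fg_free_prod U V : fg_free U -> fg_free V -> fg_free (U * V)%type.
Proof.
move=> /fg_freeP[m mU] /fg_freeP[n nV]; apply/fg_freeP; exists (m + n)%N.
exact: iso_trans (iso_sym (iso_row m n)) (iso_prod mU nV).
Qed.

Lemma fg_free_projective U : fg_free U -> fg_projective U.
Proof.
move=> /fg_freeP[n nU]; split; last exact: projective_iso nU (@projective_row n).
by apply: fin_generated_iso nU _; apply/fin_generatedP; exists n, idfun => x; exists x.
Qed.

End FinitelyGenerated.

(** * Resolution dimension relative to a class of modules *)

Section ResolutionDimension.
Variable R : nzRingType.
Implicit Types F K L M N P Q U V W X : lmodType R.

(** These closure properties make the dimension independent of the chosen covers, by Schanuel's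
    lemma. Finitely generated free modules fail [good_cancel] in general, which is why stably free
    modules are used instead. *)
Record good (p : lmodType R -> Prop) : Prop := Good {
  good_iso : forall U V, iso U V -> p U -> p V;
  good_prod : forall U V, p U -> p V -> p (U * V)%type;
  good_cancel : forall U V, p (U * V)%type -> p V -> p U;
  good_projective : forall U, p U -> projective U
}.

Lemma good_projectives : good (@projective R).
Proof.
split=> [U V|U V|U V + _|//]; first exact: projective_iso.
  exact: projective_prod.
exact: projective_fst.
Qed.

Lemma good_fg_projective : good (@fg_projective R).
Proof.
split=> [U V UV [fU pU]|U V [fU pU] [fV pV]|U V [fUV pUV] _|U []//]; split.
- exact: fin_generated_iso UV fU.
- exact: projective_iso UV pU.
- exact: fin_generated_prod.
- exact: projective_prod.
- exact: fin_generated_fst fUV.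
- exact: projective_fst pUV.
Qed.

Definition stably_free U : Prop :=
  exists F, fg_free F /\ fg_free (U * F)%type.

Lemma fg_free_stably_free U : fg_free U -> stably_free U.
Proof. by move=> fU; exists U; split=> //; apply: fg_free_prod. Qed.

Lemma good_stably_free : good stably_free.
Proof.
split=> [U V UV [F [fF fUF]]|U V [F [fF fUF]] [F' [fF' fVF']]|
         U V [F [fF fUF]] [F' [fF' fVF']]|U [F [_ /fg_free_projective[_]]]].
- exists F; split=> //; apply: fg_free_iso fUF.
  by apply: iso_prod UV _; apply: iso_refl.
- exists (F * F')%type; split; first exact: fg_free_prod.
  by apply: fg_free_iso (iso_prodACA _ _ _ _) _; apply: fg_free_prod.
- exists ((V * F') * F)%type; split; first exact: fg_free_prod.
  apply: fg_free_iso _ (fg_free_prod fUF fF').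
  apply: iso_trans (iso_sym (iso_prodA _ _ _)) _.
  apply: iso_trans (iso_sym (iso_prodA _ _ _)) _.
  apply: iso_prod (iso_refl _) _.
  apply: iso_trans _ (iso_prodA _ _ _).
  by apply: iso_prod (iso_refl _) _; apply: iso_prodC.
- exact: projective_fst.
Qed.

Lemma stably_free_fg U : stably_free U -> fin_generated U.
Proof. by move=> [F [_ /fg_free_projective[/fin_generated_fst]]]. Qed.

(** Dimension at most d is recorded by d nested short exact sequences instead of a complex, so that
    a dimension shift is a single step of the recursion. *)
Fixpoint rdim (p : lmodType R -> Prop) (d : nat) N : Prop :=
  if d is d'.+1 then
    exists K P (i : {linear K -> P}) (q : {linear P -> N}),
      [/\ ses i q, p P & rdim p d' K]
  else p N.

Variable p : lmodType R -> Prop.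
Hypothesis gp : good p.

Lemma rdim_iso d U V : iso U V -> rdim p d U -> rdim p d V.
Proof.
case: d => [|d]; first exact: (good_iso gp).
move=> [f [g [fK gK]]] [K [P [i [q [iq pP rK]]]]].
exists K, P, i, (f \o q); split=> //; apply: ses_isor iq; first exact: can_inj fK.
by move=> y; exists (g y).
Qed.

Lemma rdim_prod d U V : rdim p d U -> p V -> rdim p d (U * V)%type.
Proof.
case: d => [|d]; first exact: (good_prod gp).
move=> [K [P [i [q [[inj_i qS ex] pP rK]]]]] pV.
have [h hE] := linear_prod q (idfun : {linear V -> V}).
have [j jE] := @linear_pair R K P V i \0.
exists K, (P * V)%type, j, h; split=> //; last exact: (good_prod gp).
split=> [x y|[y v]|[x v]].
- by rewrite !jE => -[/inj_i].
- by have [x <-] := qS y; exists (x, v); rewrite hE.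
rewrite hE; split=> [[/ex[k <-] /= ->]|[k]]; first by exists k; rewrite jE.
by rewrite jE => -[<- <-] /=; congr (_, _); apply/ex; exists k.
Qed.

(** The cover Q of U * V is also a cover of U. Its new kernel is an extension of V by the old kernel
    L, and it splits because V is projective. *)
Lemma rdim_cancel d U V : rdim p d (U * V)%type -> p V -> rdim p d U.
Proof.
case: d => [|d]; first exact: (good_cancel gp).
move=> [L [Q [i [q [iq pQ rL]]]]] pV.
have [j [r [jr _]]] := ses_fst U V.
have rqS : onto (r \o q).
  move=> y; have [_ rS _] := jr; have [_ qS _] := iq.
  by have [x <-] := rS y; have [z <-] := qS x; exists z.
exists (kermod (r \o q)), Q, (ker_incl (r \o q)), (r \o q).
have kerq := ker_ses rqS; split=> //.
have [l [t lt]] := ses_compr iq jr kerq.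
have [_ tS _] := lt.
have [s sE] := good_projective gp pV (g := t) idfun tS.
by apply: rdim_iso (iso_sym (split_iso lt sE)) _; apply: rdim_prod.
Qed.

(** By Schanuel's lemma the kernels of two covers agree up to summands in p, so any cover by a
    module in p lowers the dimension. *)
Lemma rdim_cover d K P N (i : {linear K -> P}) (q : {linear P -> N}) :
  ses i q -> p P -> rdim p d.+1 N -> rdim p d K.
Proof.
move=> iq pP [K' [P' [i' [q' [iq' pP' rK']]]]].
have KP' := schanuel iq iq' (good_projective gp pP) (good_projective gp pP').
by apply: rdim_cancel (rdim_iso (iso_sym KP') (rdim_prod rK' pP)) pP'.
Qed.

(** The class is closed under cancellation, and N * U is isomorphic to U. *)
Lemma good_zero U N : p U -> zero_module N -> p N.
Proof.
move=> pU N0; apply: (good_cancel gp (V := U)) => //; apply: (good_iso gp) pU.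
have [f fE] := @linear_pair R U N U \0 idfun.
apply: (iso_bij (f := f)) => [x y|[n x]]; first by rewrite !fE => -[].
by exists x; rewrite fE /= (N0 n).
Qed.

Lemma rdimS d N : rdim p d N -> rdim p d.+1 N.
Proof.
elim: d N => [|d IHd] N; last first.
  by move=> [K [P [i [q [iq pP rK]]]]]; exists K, P, i, q; split=> //; exact: IHd.
move=> pN; exists (kermod (idfun : {linear N -> N})), N, (ker_incl _), idfun.
split=> //; first by apply: ker_ses => x; exists x.
apply: good_zero pN _ => x; apply: (@ker_incl_inj R N N idfun).
by rewrite linear0; apply/(@ker_inclP R N N idfun); exists x.
Qed.

Lemma rdim_leq d d' N : (d <= d')%N -> rdim p d N -> rdim p d' N.
Proof.
elim: d' => [|d' IHd]; first by rewrite leqn0 => /eqP ->.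
by rewrite leq_eqVlt ltnS => /orP[/eqP -> //|/IHd rN /rN]; apply: rdimS.
Qed.

(** A cover Q of F is also a cover of M; its kernel K has dimension at most d+1 and maps onto M'
    with kernel L. A cover Q' of K then covers M', and the kernel is an extension of L by K', split
    because L is projective. The bound d+2 on M leaves room for the second cover. *)
Lemma rdim_syzygy d M' F M (j : {linear M' -> F}) (q : {linear F -> M}) :
  ses j q -> rdim p 1 F -> rdim p d.+2 M -> rdim p d.+1 M'.
Proof.
move=> jq [L [Q [i [t [it pQ pL]]]]] rM.
have [_ qS _] := jq; have [_ tS _] := it.
have qtS : onto (q \o t).
  by move=> y; have [x <-] := qS y; have [z <-] := tS x; exists z.
have kerqt := ker_ses qtS.
have [K' [Q' [i' [t' [it' pQ' rK']]]]] := rdim_cover kerqt pQ rM.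
have [l [r lr]] := ses_compr it jq kerqt.
have [_ rS _] := lr; have [_ t'S _] := it'.
have rt'S : onto (r \o t').
  by move=> y; have [x <-] := rS y; have [z <-] := t'S x; exists z.
have kerrt := ker_ses rt'S.
exists (kermod (r \o t')), Q', (ker_incl _), (r \o t'); split=> //.
have [l' [r' lr']] := ses_compr it' lr kerrt.
have [_ r'S _] := lr'.
have [s sE] := good_projective gp pL (g := r') idfun r'S.
by apply: rdim_iso (iso_sym (split_iso lr' sE)) _; apply: rdim_prod.
Qed.

End ResolutionDimension.

(** * Subgroups of free abelian groups *)

Section FreeAbelian.

Lemma additive_pack (A B : zmodType) (f : A -> B) :
  {morph f : x y / x - y} -> exists g : {additive A -> B}, forall x, g x = f x.
Proof.
move=> fB; pose m := GRing.isZmodMorphism.Build A B f fB.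
pose g : {additive A -> B} := HB.pack f m.
by exists g.
Qed.

(** Such a family is a homomorphism from A to the direct sum of copies of Z indexed by I, given by
    its coordinates. *)
Definition finite_support (A : zmodType) (I : choiceType)
    (phi : I -> {additive A -> int}) : Prop :=
  forall a, exists s : seq I, forall i, phi i a <> 0 -> i \in s.

(* The unions of chains are taken over pairs (T, C) of a set T of coordinates
   and a subgroup C that phi maps isomorphically onto the elements of the image
   of phi supported in T; a pair is encoded as a subset of I + A, and 0 is
   adjoined to C so that the empty chain needs no special treatment. *)
Section Complement.
Variables (A : zmodType) (I : choiceType) (phi : I -> {additive A -> int}).
Hypothesis fin_phi : finite_support phi.

Local Open Scope classical_set_scope.

Let T (X : set (I + A)) (i : I) : Prop := X (inl i).
Let C (X : set (I + A)) (a : A) : Prop := X (inr a) \/ a = 0.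
Let supported (t : I -> Prop) (a : A) : Prop := forall i, phi i a <> 0 -> t i.

Let partial_complement (X : set (I + A)) : Prop :=
  [/\ forall a b, C X a -> C X b -> C X (a - b),
      forall a, C X a -> (forall i, phi i a = 0) -> a = 0,
      forall a, C X a -> supported (T X) a &
      forall a, supported (T X) a ->
        exists2 c, C X c & forall i, phi i c = phi i a].

Let chain_union (F : set (set (I + A))) :
  F `<=` partial_complement -> total_on F subset ->
  partial_complement (\bigcup_(X in F) X).
Proof.
move=> FP totF; set U := \bigcup_(X in F) X.
have CU X a : F X -> C X a -> C U a by move=> FX [Xa|->]; [left; exists X | right].
have TU X i : F X -> T X i -> T U i by move=> FX Xi; exists X.
have CX a : C U a -> a = 0 \/ exists2 X, F X & C X a.
  by move=> [[X FX Xa]|->]; [right; exists X => //; left | left].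
have C2 a b : C U a -> C U b -> (a = 0 /\ b = 0) \/ exists X, [/\ F X, C X a & C X b].
  have C0 X : C X 0 by right.
  move=> /CX Ca /CX Cb.
  case: Ca Cb => [->|[X FX Xa]] [->|[Y FY Yb]]; first by left.
  - by right; exists Y.
  - by right; exists X.
  right.
  have [XY|YX] := totF _ _ FX FY.
    by exists Y; split=> //; case: Xa => [/XY|->]; [left|right].
  by exists X; split=> //; case: Yb => [/YX|->]; [left|right].
have Tfin (s : seq I) : (forall i, i \in s -> T U i) ->
    s = [::] \/ exists2 X, F X & forall i, i \in s -> T X i.
  elim: s => [|i s IHs] sT; [by left | right].
  have [X FX Xi] : T U i by apply: sT; rewrite mem_head.
  have [|->|[Y FY Ys]] := IHs; first by move=> j js; apply: sT; rewrite inE js orbT.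
    by exists X => // j; rewrite inE => /eqP ->.
  have [XY|YX] := totF _ _ FX FY.
    by exists Y => // j; rewrite inE => /predU1P[->|/Ys //]; apply: XY.
  by exists X => // j; rewrite inE => /predU1P[-> //|/Ys]; apply: YX.
split=> [a b Ca Cb|a Ca a0|a Ca i ai|a sa].
- have [[-> ->]|[X [FX Xa Xb]]] := C2 a b Ca Cb; first by right; rewrite subr0.
  have [XB _ _ _] := FP _ FX; exact: CU FX (XB _ _ Xa Xb).
- have [//|[X FX Xa]] := CX a Ca.
  have [_ X0 _ _] := FP _ FX; exact: X0 Xa a0.
- have [a0|[X FX Xa]] := CX a Ca; first by case: ai; rewrite a0 raddf0.
  have [_ _ Xsupp _] := FP _ FX; exact: TU FX (Xsupp _ Xa _ ai).
(* Finiteness of the support places all coordinates of a in a single member of the chain, where a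
   preimage exists; if the support is empty, 0 serves. *)
have [s sP] := fin_phi a.
have [|s0|[X FX Xs]] := Tfin [seq i <- s | phi i a != 0].
- by move=> i; rewrite mem_filter => /andP[/eqP /sa].
- exists 0; first by right.
  move=> i; rewrite raddf0; apply/esym/eqP/negPn/negP => ai.
  by have : i \in [::] by rewrite -s0 mem_filter ai; apply/sP/eqP.
have [_ _ _ Xsurj] := FP _ FX; have [|c Xc cE] := Xsurj a.
  by move=> i ai; apply: Xs; rewrite mem_filter sP // andbT; apply/eqP.
by exists c => //; exact: CU FX Xc.
Qed.

(** The values of phi i on elements supported in T and i form an ideal of Z. If it is zero, the
    coordinate i is added and C is kept. Otherwise an element a0 with value of least positive size
    generates the ideal by Euclidean division, and the multiples of a0 are added to C. *)
Let extension (X : set (I + A)) (i : I) : partial_complement X -> ~ T X i ->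
  exists2 Y, X `<` Y & partial_complement Y.
Proof.
move=> [XB X0 Xsupp Xsurj] nTi.
have proper (Y : set (I + A)) : X `<=` Y -> Y (inl i) -> X `<` Y.
  by move=> XY Yi; split=> // /(_ _ Yi).
pose Ti j := T X j \/ j = i.
have [[a1 [sa1 a1i]]|none] := pselect (exists a, supported Ti a /\ phi i a <> 0); last first.
  have CE a : C (X `|` [set inl i]) a -> C X a.
    by case=> [[Xa|//]|->]; [left|right].
  exists (X `|` [set inl i]); first by apply: proper => [x Xx|]; [left|right].
  split=> [a b /CE Xa /CE Xb|a /CE|a /CE Xa j aj|a sa].
  - by case: (XB _ _ Xa Xb) => [Xab|->]; [left; left|right].
  - exact: X0.
  - by left; apply: Xsupp Xa j aj.
  have [|c Xc cE] := Xsurj a.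
    move=> j aj; case: (sa j aj) => [//|[ji]]; case: none; exists a.
    by rewrite -ji; split=> // k /sa[Xk|[->]]; [left|right].
  by exists c => //; case: Xc => [Xc|->]; [left; left|right].
pose size_at n := `[< exists a, [/\ supported Ti a, phi i a <> 0 & `|phi i a|%N = n] >].
have ex_size : exists n, size_at n by exists `|phi i a1|%N; apply/asboolP; exists a1.
case: (ex_minnP ex_size) => n /asboolP[a0 [sa0 a0i nE]] n_min.
have dvd_a0 a : supported Ti a -> exists q, phi i a = q * phi i a0.
  move=> sa; exists (divz (phi i a) (phi i a0)).
  set q := divz _ _; pose r := a - a0 *~ q.
  have rE : phi i r = modz (phi i a) (phi i a0).
    by rewrite raddfB raddfMz /= /modz mulrzz mulrC.
  have [r0|r0] := eqVneq (phi i r) 0.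
    by rewrite [LHS](divz_eq _ (phi i a0)) -rE r0 addr0.
  suff /n_min : size_at `|phi i r|%N.
    rewrite -nE leqNgt => /negP[]; rewrite -ltz_nat !abszE rE.
    by rewrite ger0_norm ?modz_ge0 ?ltz_mod //; apply/eqP.
  apply/asboolP; exists r; split=> //; last exact/eqP.
  move=> j rj; have [aj|/eqP aj] := eqVneq (phi j a) 0; last exact: sa.
  by apply: sa0 => a0j; case: rj; rewrite raddfB raddfMz aj a0j mul0rz subrr.
pose Y : set (I + A) := fun x => match x with
  | inl j => Ti j | inr a => exists c m, C X c /\ a = c + a0 *~ m end.
have CY a : C Y a -> exists c m, C X c /\ a = c + a0 *~ m.
  by case=> [//|->]; exists 0, 0; split; [right | rewrite mulr0z addr0].
exists Y.
  apply: proper; last by right.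
  move=> [j|a] Xx; [by left | exists a, 0]; by rewrite mulr0z addr0; split=> //; left.
split=> [_ _ /CY[c [m [Xc ->]]] /CY[d [k [Xd ->]]]|_ /CY[c [m [Xc ->]]] c0|
         _ /CY[c [m [Xc ->]]] j cj|a sa].
- left; exists (c - d), (m - k); split; first exact: XB.
  by rewrite mulrzBr opprD addrACA.
- have ci : phi i c = 0 by apply/eqP/negPn/negP => /eqP /(Xsupp c Xc).
  have m0 : m = 0.
    have := c0 i; rewrite raddfD raddfMz ci add0r => /eqP.
    by rewrite mulrz_eq0 => /orP[/eqP //|/eqP].
  rewrite m0 mulr0z addr0 in c0 *; exact: X0 c Xc c0.
- have [c0|/eqP c0] := eqVneq (phi j c) 0; last by left; apply: Xsupp Xc j c0.
  apply: (sa0 j) => a0j; case: cj.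
  by rewrite raddfD raddfMz c0 a0j mul0rz addr0.
have [q qE] := dvd_a0 a sa.
have [|c Xc cE] := Xsurj (a - a0 *~ q).
  move=> j; have [->|] := eqVneq j i.
    by rewrite raddfB raddfMz qE mulrzz mulrC subrr.
  move=> ji rj; have [aj|/eqP aj] := eqVneq (phi j a) 0; last first.
    by case: (sa j aj) => // jE; rewrite jE eqxx in ji.
  have [a0j|/eqP a0j] := eqVneq (phi j a0) 0.
    by case: rj; rewrite raddfB raddfMz aj a0j mul0rz subrr.
  by case: (sa0 j a0j) => // jE; rewrite jE eqxx in ji.
exists (c + a0 *~ q); first by left; exists c, q.
by move=> j; rewrite raddfD cE raddfB subrK.
Qed.

(** For a maximal pair T is all of I, so C is a complement of the common kernel of the phi i; the
    map u is the projection onto C along that kernel. *)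
Lemma additive_section : exists u : {additive A -> A},
  (forall a i, phi i (u a) = phi i a) /\ forall a, (forall i, phi i a = 0) -> u a = 0.
Proof.
have [X [PX Xmax]] := Zorn_bigcup chain_union.
have [XB X0 _ Xsurj] := PX; have TX i : T X i.
  have [//|nTi] := pselect (T X i).
  by have [Y XY PY] := extension PX nTi; case: (Xmax Y XY).
have /choice[u uP] : forall a, exists c, C X c /\ forall i, phi i c = phi i a.
  by move=> a; have [//|c Xc cE] := Xsurj a; exists c.
have CX a : C X (u a) by have [] := uP a.
have uE a i : phi i (u a) = phi i a by have [] := uP a.
have uniq a b : C X a -> C X b -> (forall i, phi i a = phi i b) -> a = b.
  move=> Xa Xb ab; apply/eqP; rewrite -subr_eq0; apply/eqP/X0; first exact: XB.
  by move=> i; rewrite raddfB ab subrr.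
have [|v vE] := @additive_pack A A u.
  by move=> a b; apply: uniq => // [|i]; [exact: XB | rewrite !raddfB !uE raddfB].
exists v; split=> [a i|a a0]; rewrite vE ?uE //.
by apply: uniq => // [|i]; [right | rewrite uE a0 raddf0].
Qed.

End Complement.

(** This amounts to being free abelian, but in this form the property passes to subgroups at
    once. *)
Definition zfree_embeddable (A : zmodType) : Prop :=
  exists (I : choiceType) (phi : I -> {additive A -> int}),
    finite_support phi /\ forall a, (forall i, phi i a = 0) -> a = 0.

Lemma zfree_embeddable_inj (A B : zmodType) (f : {additive A -> B}) :
  injective f -> zfree_embeddable B -> zfree_embeddable A.
Proof.
move=> inj_f [I [phi [fin_phi phi0]]].
exists I, (fun i => phi i \o f); split=> a; first exact: (fin_phi (f a)).
by move=> fa; apply: inj_f; rewrite raddf0; apply: phi0.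
Qed.

(** The kernel of g, which is the image of f, is a direct summand of B because the image of g is
    free; the kernel of f is a summand of A because the image of f is free. With v and u the
    projections onto complements, s sends b to u of a preimage of b - v b. *)
Lemma additive_splitting (A B D : zmodType) (f : {additive A -> B})
    (g : {additive B -> D}) :
  zfree_embeddable B -> zfree_embeddable D ->
  (forall b, g b = 0 <-> exists a, f a = b) ->
  exists s : {additive B -> A}, forall a, f (s (f a)) = f a.
Proof.
move=> [I [phi [fin_phi phi0]]] [J [psi [fin_psi psi0]]] ex.
have [u [uE u0]] := @additive_section A I (fun i => phi i \o f) (fun a => fin_phi (f a)).
have [v [vE v0]] := @additive_section B J (fun j => psi j \o g) (fun b => fin_psi (g b)).
have fu a : f (u a) = f a.
  apply/eqP; rewrite -subr_eq0; apply/eqP/phi0 => i.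
  by rewrite raddfB [phi i (f (u a))]uE subrr.
have gv b : g (v b) = g b.
  apply/eqP; rewrite -subr_eq0; apply/eqP/psi0 => i.
  by rewrite raddfB [psi i (g (v b))]vE subrr.
have /choice[t tE] : forall b, exists a, f a = b - v b.
  by move=> b; apply/ex; rewrite raddfB gv subrr.
have uf a a' : f a = f a' -> u a = u a'.
  move=> eq_f; apply/eqP; rewrite -subr_eq0 -raddfB; apply/eqP/u0 => i /=.
  by rewrite raddfB eq_f subrr raddf0.
have [|s sE] := @additive_pack B A (fun b => u (t b)).
  move=> a b; rewrite -raddfB; apply: uf; rewrite raddfB !tE raddfB !opprD !opprK.
  by rewrite !addrA; congr (_ + _); rewrite addrAC.
exists s => a; rewrite sE fu tE; have -> : v (f a) = 0; last by rewrite subr0.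
have gfa : g (f a) = 0 by apply/ex; exists a.
by apply: v0 => i /=; rewrite gfa raddf0.
Qed.

End FreeAbelian.

(** * Resolutions *)

Section FreeModules.

(** The map out of a direct sum of copies of W with components [h k]. It serves both for free
    R-modules, with W = R, and for the group ring itself, with W = Z. *)
Definition malg_lift (W V : zmodType) (K : choiceType) (h : K -> {additive W -> V})
    (a : {malg W[K]}) : V := \sum_(k <- msupp a) h k a@_k.

Section Lift.
Variables (W V : zmodType) (K : choiceType) (h : K -> {additive W -> V}).

Lemma malg_liftw (d : {fset K}) (a : {malg W[K]}) :
  (msupp a `<=` d)%fset -> malg_lift h a = \sum_(k <- d) h k a@_k.
Proof.
by move=> le; apply: (big_fset_incl _ le) => x _ /mcoeff_outdom ->; rewrite raddf0.
Qed.

Fact malg_liftB : {morph malg_lift h : a b / a - b}.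
Proof.
move=> a b; rewrite (malg_liftw (msuppB_le a b)).
rewrite (malg_liftw (fsubsetUl (msupp a) (msupp b))).
rewrite (malg_liftw (fsubsetUr (msupp a) (msupp b))).
by rewrite -sumrB; apply: eq_bigr => k _; rewrite mcoeffB raddfB.
Qed.

HB.instance Definition _ :=
  GRing.isZmodMorphism.Build {malg W[K]} V (malg_lift h) malg_liftB.

Lemma malg_liftU w k : malg_lift h << w *g k >> = h k w.
Proof. by rewrite (malg_liftw msuppU_le) big_seq_fset1 mcoeffUU. Qed.

End Lift.

Variable R : nzRingType.

Lemma malg_linear (K : choiceType) (V : lmodType R) (h : K -> V) :
  exists f : {linear {malg R[K]} -> V}, forall k, f << 1 *g k >> = h k.
Proof.
have /choice[s sE] : forall k, exists s : {additive R -> V}, forall a, s a = a *: h k.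
  by move=> k; apply: additive_pack => a b; rewrite scalerBl.
have [|f fE] := @linear_pack R {malg R[K]} V (malg_lift s).
  move=> a x y; rewrite raddfD; congr (_ + _).
  rewrite /= (malg_liftw s (msuppZ_le a x)) scaler_sumr.
  by apply: eq_bigr => k _; rewrite mcoeffZ !sE scalerA.
by exists f => k; rewrite fE malg_liftU sE scale1r.
Qed.

Lemma malgU_scale (K : choiceType) (a : R) (k : K) :
  << a *g k >> = a *: << 1 *g k >> :> {malg R[K]}.
Proof.
by apply/malgP => x; rewrite mcoeffZ !mcoeffU; case: eqP; rewrite ?mulr1 ?mulr0.
Qed.

Lemma projective_malg (K : choiceType) : projective {malg R[K]}.
Proof.
move=> M N g f gS.
have /choice[e eP] : forall k, exists x, g x = f << 1 *g k >> by move=> k; exact: gS.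
have [h hE] := malg_linear e; exists h => a.
rewrite [a in LHS]monalgE [a in RHS]monalgE !raddf_sum /=; apply: eq_bigr => k _.
by rewrite malgU_scale !linearZ /= hE eP.
Qed.

Lemma counit_exists (N : lmodType R) :
  exists f : {linear {malg R[N]} -> N}, onto f.
Proof.
by have [f fE] := @malg_linear N N idfun; exists f => x; exists << 1 *g x >>.
Qed.

Definition counit (N : lmodType R) : {linear {malg R[N]} -> N} :=
  sval (cid (counit_exists N)).

Lemma counit_surj (N : lmodType R) : onto (counit N).
Proof. exact: svalP (cid (counit_exists N)). Qed.

(** Covering each module by the free module on its own elements is canonical, so a resolution is
    obtained by plain iteration. *)
Definition syzygy (j : nat) (N : lmodType R) : lmodType R :=
  iter j (fun N' : lmodType R => kermod (counit N') : lmodType R) N.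

Lemma projective_resolution (N : lmodType R) :
  exists F : resolution N, res_all (@projective R) F.
Proof.
pose F j : lmodType R := {malg R[syzygy j N]}.
pose d j : {linear F j.+1 -> F j} :=
  ker_incl (counit (syzygy j N)) \o counit (syzygy j.+1 N).
have d0 j x : counit (syzygy j N) x = 0 <-> exists y, d j y = x.
  rewrite ker_inclP; split=> [[k <-]|[y <-]]; last by exists (counit (syzygy j.+1 N) y).
  by have [y <-] := counit_surj (N := syzygy j.+1 N) k; exists y.
unshelve eexists (@Resolution R N F d (counit N) _ _ _).
- exact: counit_surj.
- exact: (d0 0).
- move=> j x; rewrite -d0; apply: (linear_inj_eq0 (i := ker_incl _)).
  exact: ker_incl_inj.
by move=> j; apply: projective_malg.
Qed.

Lemma res_map_comp (M : lmodType R) (F : resolution M) j x :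
  res_map F j (res_map F j.+1 x) = 0.
Proof. by apply/res_exact; exists x. Qed.

Lemma res_aug_comp (M : lmodType R) (F : resolution M) x :
  res_aug F (res_map F 0 x) = 0.
Proof. by apply/res_exact0; exists x. Qed.

End FreeModules.

(** * Shifting and splicing of resolutions *)

Section Shift.
Variables (R : nzRingType) (M : lmodType R) (F : resolution M).

Fact shift_aug_exists : exists f : {linear F 1 -> kermod (res_aug F)},
  forall x, ker_incl (res_aug F) (f x) = res_map F 0 x.
Proof.
apply: linear_lift; first exact: ker_incl_inj.
by move=> x; apply/ker_inclP; exact: res_aug_comp.
Qed.

Definition shift_aug := sval (cid shift_aug_exists).

Lemma shift_augE x : ker_incl (res_aug F) (shift_aug x) = res_map F 0 x.
Proof. exact: (svalP (cid shift_aug_exists)). Qed.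

Fact shift_aug_surj : onto shift_aug.
Proof.
move=> k; have /res_exact0[y yE] : res_aug F (ker_incl (res_aug F) k) = 0.
  by apply/ker_inclP; exists k.
by exists y; apply: (@ker_incl_inj _ _ _ (res_aug F)); rewrite shift_augE.
Qed.

Fact shift_exact0 x : shift_aug x = 0 <-> exists y, res_map F 1 y = x.
Proof.
rewrite -res_exact -shift_augE; apply: iff_sym.
apply: (linear_inj_eq0 (i := ker_incl (res_aug F))).
exact: ker_incl_inj.
Qed.

Definition shift : resolution (kermod (res_aug F)) :=
  @Resolution R _ (fun j => F j.+1) (fun j => res_map F j.+1) shift_aug
    shift_aug_surj shift_exact0 (fun j => @res_exact _ _ F j.+1).

End Shift.

Section Splice.
Variables (R : nzRingType) (K P N : lmodType R).
Variables (i : {linear K -> P}) (p : {linear P -> N}).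
Hypothesis ip : ses i p.
Variable F : resolution K.

Definition splice_mod (j : nat) : lmodType R := if j is j'.+1 then F j' else P.

(** Above degree 0 the differentials are those of F up to conversion, so exactness and periodicity
    of F carry over without transport. *)
Definition splice_map (j : nat) : {linear splice_mod j.+1 -> splice_mod j} :=
  match j with
  | 0 => i \o res_aug F
  | j'.+1 => res_map F j'
  end.

Fact splice_surj : onto p.
Proof. by case: ip. Qed.

Fact splice_exact0 x : p x = 0 <-> exists y, splice_map 0 y = x.
Proof.
case: ip => _ _ ->; split=> [[k <-]|[y <-]]; last by exists (res_aug F y).
by have [y <-] := res_aug_surj F k; exists y.
Qed.

Fact splice_exact j x : splice_map j x = 0 <-> exists y, splice_map j.+1 y = x.
Proof.
case: j x => [|j] x; last exact: res_exact.
rewrite -[X in _ <-> X]res_exact0; apply: (linear_inj_eq0 (i := i)).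
by case: ip.
Qed.

Definition splice : resolution N :=
  Resolution splice_surj splice_exact0 splice_exact.

End Splice.

(** * Projective dimension over a group ring *)

Section GroupRingModules.
Variable G : groupType.
Local Notation R := (groupring G).
Implicit Types P Q X Y N : lmodType R.

Definition gelt (g : G) : R := << 1 *g g >>.

Lemma gelt1 : gelt 1%g = 1.
Proof. by []. Qed.

Lemma geltM g h : gelt (g * h)%g = gelt g * gelt h.
Proof. by rewrite [RHS](gr_mulUU 1 1 g h) mulr1. Qed.

Lemma geltVK g : gelt g * gelt g^-1%g = 1.
Proof. by rewrite -geltM mulgV. Qed.

Lemma geltKV g : gelt g^-1%g * gelt g = 1.
Proof. by rewrite -geltM mulVg. Qed.

Lemma gr_sum (r : R) : r = \sum_(g <- msupp r) gelt g *~ r@_g.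
Proof.
rewrite [LHS]monalgE; apply: eq_bigr => g _.
by rewrite -[r@_g in LHS]intz -raddfMz.
Qed.

(** Group elements generate R additively. To check an identity that is additive in r on group
    elements only, later proofs first package both of its sides as additive maps. *)
Lemma gr_additive_ext (V : zmodType) (f f' : {additive R -> V}) :
  (forall g, f (gelt g) = f' (gelt g)) -> forall r, f r = f' r.
Proof.
move=> eq_f r; rewrite (gr_sum r) !raddf_sum.
by apply: eq_bigr => g _; rewrite !raddfMz eq_f.
Qed.

Lemma gr_linear (U V : lmodType R) (f : U -> V) :
  {morph f : x y / x - y} ->
  (forall g x, f (gelt g *: x) = gelt g *: f x) ->
  exists h : {linear U -> V}, forall x, h x = f x.
Proof.
move=> /additive_pack[h hE] fZ.
apply: linear_pack => a x y; rewrite -!hE raddfD; congr (_ + _).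
rewrite (gr_sum a) !scaler_suml raddf_sum; apply: eq_bigr => g _.
by rewrite -!scalerMzl raddfMz !hE fZ.
Qed.

(** * Additive maps with the conjugation action *)

Section AdditiveMaps.
Variables Q X : lmodType R.

Definition addmap_pred : {pred Q -> X} :=
  [pred f | `[< {morph f : x y / x - y} >]].

Fact addmap_zmod_closed : zmod_closed addmap_pred.
Proof.
split=> [|f g /asboolP fB /asboolP gB]; apply/asboolP => x y.
  by rewrite [LHS]/0 subr0.
rewrite -[(f - g) _]/(f _ - g _) -[(f - g) x]/(f _ - g _) -[(f - g) y]/(f _ - g _).
by rewrite fB gB !opprD addrACA.
Qed.

HB.instance Definition _ :=
  GRing.isZmodClosed.Build (Q -> X) addmap_pred addmap_zmod_closed.

(** The module Hom_Z(Q, X), on which g acts by sending t to g t g^-1; [conj_act] extends this action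
    to R by additivity. *)
Definition addmap : Type := {f : Q -> X | f \in addmap_pred}.
HB.instance Definition _ := SubChoice.on addmap.
HB.instance Definition _ := [SubChoice_isSubZmodule of addmap by <:].

Definition amap (t : addmap) : Q -> X := val t.

Lemma amap_eq (t t' : addmap) : (forall q, amap t q = amap t' q) -> t = t'.
Proof. by move=> eq_t; apply: val_inj; apply: funext. Qed.

Lemma amapB (t : addmap) : {morph amap t : x y / x - y}.
Proof. exact/asboolP/(valP t). Qed.

Lemma amap_sub (t t' : addmap) q : amap (t - t') q = amap t q - amap t' q.
Proof. by []. Qed.

Lemma amap0 q : amap 0 q = 0.
Proof. by []. Qed.

Lemma addmap_exists (f : Q -> X) :
  {morph f : x y / x - y} -> exists t : addmap, forall q, amap t q = f q.
Proof.
move=> fB; have ft : f \in addmap_pred by apply/asboolP.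
by exists (exist _ f ft).
Qed.

Fact conj_exists (t : addmap) (q : Q) (g : G) :
  exists h : {additive int -> X},
    forall a, h a = (gelt g *: amap t (gelt g^-1%g *: q)) *~ a.
Proof. by apply: additive_pack => a b; rewrite mulrzBr. Qed.

Definition conj_coeff t q g := sval (cid (conj_exists t q g)).

Lemma conj_coeffE t q g a :
  conj_coeff t q g a = (gelt g *: amap t (gelt g^-1%g *: q)) *~ a.
Proof. exact: (svalP (cid (conj_exists t q g))). Qed.

Fact conj_act_exists (r : R) (t : addmap) :
  exists t' : addmap, forall q, amap t' q = malg_lift (conj_coeff t q) r.
Proof.
apply: addmap_exists => x y; rewrite /malg_lift -sumrB; apply: eq_bigr => g _.
by rewrite !conj_coeffE scalerBr amapB scalerBr mulrzBl.
Qed.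

Definition conj_act r t : addmap := sval (cid (conj_act_exists r t)).

Lemma conj_actE r t q : amap (conj_act r t) q = malg_lift (conj_coeff t q) r.
Proof. exact: (svalP (cid (conj_act_exists r t))). Qed.

Lemma conj_act_gelt g t q :
  amap (conj_act (gelt g) t) q = gelt g *: amap t (gelt g^-1%g *: q).
Proof. by rewrite conj_actE malg_liftU conj_coeffE. Qed.

Fact conj_actBl t : {morph conj_act^~ t : r r' / r - r'}.
Proof.
by move=> r r'; apply: amap_eq => q; rewrite amap_sub !conj_actE raddfB.
Qed.

Fact conj_actBr r : {morph conj_act r : t t' / t - t'}.
Proof.
move=> t t'; apply: amap_eq => q; rewrite amap_sub !conj_actE /malg_lift -sumrB.
by apply: eq_bigr => g _; rewrite !conj_coeffE amap_sub scalerBr mulrzBl.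
Qed.

Fact conj_actA r r' t : conj_act r (conj_act r' t) = conj_act (r * r') t.
Proof.
have [f fE] := additive_pack (conj_actBl t).
have [f1 f1E] := additive_pack (conj_actBl (conj_act r' t)).
have [f2 f2E] : exists f2 : {additive R -> addmap},
    forall s, f2 s = conj_act (s * r') t.
  by apply: additive_pack => a b; rewrite mulrBl conj_actBl.
rewrite -f1E -f2E; apply: gr_additive_ext => g; rewrite f1E f2E.
have [f3 f3E] : exists f3 : {additive R -> addmap},
    forall s, f3 s = conj_act (gelt g) (conj_act s t).
  by apply: additive_pack => a b; rewrite conj_actBl conj_actBr.
have [f4 f4E] : exists f4 : {additive R -> addmap},
    forall s, f4 s = conj_act (gelt g * s) t.
  by apply: additive_pack => a b; rewrite mulrBr conj_actBl.
rewrite -f3E -f4E; apply: gr_additive_ext => h; rewrite f3E f4E.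
apply: amap_eq => q; rewrite -geltM !conj_act_gelt !scalerA -geltM -geltM.
by rewrite invgM.
Qed.

Fact conj_act1 : left_id 1 conj_act.
Proof.
move=> t; apply: amap_eq => q.
by rewrite -gelt1 conj_act_gelt invg1 !scale1r.
Qed.

Fact conj_actDr : right_distributive conj_act +%R.
Proof.
move=> r t t'; have [f fE] := additive_pack (conj_actBr r).
by rewrite -!fE raddfD.
Qed.

Fact conj_actDl t : {morph conj_act^~ t : r r' / r + r'}.
Proof.
by move=> r r'; have [f fE] := additive_pack (conj_actBl t); rewrite -!fE raddfD.
Qed.

HB.instance Definition _ := GRing.Zmodule_isLmodule.Build R addmap
  conj_actA conj_act1 conj_actDr conj_actDl.

Lemma amap_gelt g (t : addmap) q :
  amap (gelt g *: t) q = gelt g *: amap t (gelt g^-1%g *: q).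
Proof. exact: conj_act_gelt. Qed.

End AdditiveMaps.

Lemma addmap_precomp (Q Q' X : lmodType R) (e : {linear Q -> Q'}) :
  exists f : {linear addmap Q' X -> addmap Q X},
    forall t q, amap (f t) q = amap t (e q).
Proof.
have /choice[f fE] : forall t : addmap Q' X, exists t' : addmap Q X,
    forall q, amap t' q = amap t (e q).
  by move=> t; apply: addmap_exists => x y; rewrite linearB amapB.
have [|g t|h hE] := @gr_linear (addmap Q' X) (addmap Q X) f.
- by move=> t t'; apply: amap_eq => q; rewrite amap_sub !fE.
- by apply: amap_eq => q; rewrite fE !amap_gelt fE linearZ.
by exists h => t q; rewrite hE fE.
Qed.

(** These are the linear maps to X from the tensor product of P and Q over Z with the diagonal
    action of G. *)
Record equivariant_biadditive (P Q X : lmodType R) (b : P -> Q -> X) : Prop := {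
  biaddBl : forall p p' q, b (p - p') q = b p q - b p' q;
  biaddBr : forall p q q', b p (q - q') = b p q - b p q';
  biadd_equiv : forall g p q, b (gelt g *: p) (gelt g *: q) = gelt g *: b p q
}.

Lemma biadd_flip P Q X (b : P -> Q -> X) :
  equivariant_biadditive b -> equivariant_biadditive (fun q p => b p q).
Proof. by case=> bl br be; split. Qed.

Lemma biadd0 P Q X (b : P -> Q -> X) p : equivariant_biadditive b -> b p 0 = 0.
Proof. by case=> _ br _; rewrite -(subrr 0) br subrr. Qed.

Lemma biadd_comp P P' Q Q' X (f : {linear P' -> P}) (g : {linear Q' -> Q})
    (b : P -> Q -> X) : equivariant_biadditive b ->
  equivariant_biadditive (fun p q => b (f p) (g q)).
Proof.
by case=> bl br be; split=> *; rewrite ?linearB ?linearZ ?bl ?br ?be.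
Qed.

(* b amounts to a linear map from P to the module of additive maps Q -> X,
   and those vanishing on the kernel of e are, by the splitting s, the ones
   that factor through e; projectivity of P lifts b. *)
Lemma biadd_extend P Q Q' X (e : {linear Q -> Q'}) (s : {additive Q' -> Q})
    (b : P -> Q -> X) :
  projective P -> (forall q, e (s (e q)) = e q) -> equivariant_biadditive b ->
  (forall p q, e q = 0 -> b p q = 0) ->
  exists c : P -> Q' -> X,
    equivariant_biadditive c /\ forall p q, b p q = c p (e q).
Proof.
move=> pP es bP b0; have [bl br be] := bP.
have /choice[f0 f0E] : forall p, exists t : addmap Q X, forall q, amap t q = b p q.
  by move=> p; apply: addmap_exists.
have [p p'|g p|f fE] := @gr_linear P (addmap Q X) f0.
- by apply: amap_eq => q; rewrite amap_sub !f0E bl.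
- apply: amap_eq => q; rewrite amap_gelt !f0E -be.
  by rewrite [in RHS]scalerA geltVK scale1r.
have [pe peE] := addmap_precomp X e; have [pk pkE] := addmap_precomp X (ker_incl e).
have [t t0|p|h hE] := @projective_lift_exact R P _ _ _ pe pk f pP.
- have [|t' t'E] := @addmap_exists Q' X (fun q' => amap t (s q')).
    by move=> x y; rewrite raddfB amapB.
  exists t'; apply: amap_eq => q; rewrite peE t'E.
  apply/eqP; rewrite -subr_eq0 -amapB.
  have /ker_inclP[k <-] : e (s (e q) - q) = 0 by rewrite linearB es subrr.
  by rewrite -pkE t0 amap0.
- apply: amap_eq => k; rewrite pkE fE f0E amap0; apply: b0.
  by apply/ker_inclP; exists k.
exists (fun p q' => amap (h p) q'); split; last first.
  by move=> p q; rewrite -peE hE fE f0E.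
split=> [p p' q|p q q'|g p q]; rewrite ?linearB ?amap_sub ?amapB //.
by rewrite linearZ amap_gelt scalerA geltKV scale1r.
Qed.

(** A projective module embeds in a free one, whose integer coordinates are indexed by a basis
    element and a group element. *)
Lemma zfree_embeddable_projective (P : lmodType R) :
  projective P -> zfree_embeddable P.
Proof.
move=> pP; have [s sK] := pP _ _ (counit P) idfun (counit_surj (N := P)).
apply: (@zfree_embeddable_inj P {malg R[P]} s); first exact: can_inj sK.
exists (P * G)%type, (fun kg => mcoeff kg.2 \o mcoeff kg.1); split=> [a|a a0].
  exists [seq (k, g) | k <- msupp a, g <- msupp (a@_k : R)] => -[k g] /= kg.
  have gk : g \in msupp (a@_k : R) by rewrite -mcoeff_neq0; apply/eqP.
  apply/allpairsPdep; exists k, g; split=> //.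
  by rewrite -mcoeff_neq0; apply: contraTneq gk => ->; rewrite msupp0.
apply/malgP => k; rewrite mcoeff0; apply: (proj1 (@malgP G int _ 0)) => g.
by rewrite mcoeff0; exact: (a0 (k, g)).
Qed.

Lemma zfree_embeddable_trivial : zfree_embeddable (trivial_module G).
Proof.
have [f fE] := @additive_pack (trivial_module G) int (fun z => z) (fun _ _ => erefl).
exists (unit : choiceType), (fun _ => f).
by split=> [a|a a0]; [exists [:: tt] => -[] | rewrite -[LHS]fE (a0 tt)].
Qed.

(** Each boundary splits because the next module to the right is free over Z. In degree 0 that
    module is N itself, and this is where N has to be free over Z. *)
Lemma resolution_splitting (N : lmodType R) (F : resolution N) :
  zfree_embeddable N -> (forall j, zfree_embeddable (F j)) ->
  forall j, exists s : {additive F j -> F j.+1},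
    forall x, res_map F j (s (res_map F j x)) = res_map F j x.
Proof.
move=> zN zF [|j].
  exact: (additive_splitting (f := res_map F 0) (g := res_aug F)
    (zF 0) zN (@res_exact0 _ _ F)).
exact: (additive_splitting (f := res_map F j.+1) (g := res_map F j)
  (zF _) (zF _) (@res_exact _ _ F j)).
Qed.

(** * The double complex of biadditive maps *)

Section DoubleComplex.
Variables (Y N : lmodType R) (P : resolution Y) (Q : resolution N) (n : nat).
Hypotheses (pP : res_all (@projective _) P) (pQ : res_all (@projective _) Q).
Hypotheses (zY : zfree_embeddable Y) (zN : zfree_embeddable N).
Hypothesis lenP : res_length_le P n.

Let splitP := resolution_splitting zY (fun j => zfree_embeddable_projective (@pP j)).
Let splitQ := resolution_splitting zN (fun j => zfree_embeddable_projective (@pQ j)).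

(* The induction runs along the antidiagonals of the double complex of
   equivariant biadditive maps P_i x Q_j -> X. *)
Lemma biadd_coboundary (X : lmodType R) k i m (b : P i -> Q m.+1 -> X) :
  (i + k = n)%N -> (k <= m)%N -> equivariant_biadditive b ->
  (forall p q, b (res_map P i p) q = 0) ->
  (forall p q, res_map Q m q = 0 -> b p q = 0) ->
  exists c : P i -> Q m -> X, [/\ equivariant_biadditive c,
    forall p q, c (res_map P i p) q = 0 & forall p q, b p q = c p (res_map Q m q)].
Proof.
elim: k i m b => [|k IHk] i m b.
  (* Here i = n, so P i.+1 is zero and every factorization of b vanishes on boundaries from P. *)
  rewrite addn0 => i_n _ bP b1 b2; have [s sE] := splitQ m.
  have [c [cP cE]] := biadd_extend (@pP i) sE bP b2.
  exists c; split=> // p q; have p0 : p = 0 by apply: lenP; rewrite i_n.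
  by rewrite p0 linear0 (biadd0 _ (biadd_flip cP)).
case: m b => [//|m] b ikn; rewrite ltnS => km bP b1 b2.
have [s sE] := splitQ m.+1.
have [f [fP fE]] := biadd_extend (@pP i) sE bP b2.
(* The factorization f need not vanish on boundaries from P. Its failure to do so is again a map of
   the kind treated by the lemma, one place further along the antidiagonal. *)
have [|//|||p q|c [cP c1 cE]] := IHk i.+1 m (fun p q => f (res_map P i p) q).
- by rewrite addSnnS.
- exact: (biadd_comp (res_map P i) idfun fP).
- by move=> p q; rewrite res_map_comp (biadd0 _ (biadd_flip fP)).
- by move=> /res_exact[q' <-]; rewrite -fE b1.
(* As c vanishes on boundaries from P, it factors through [res_map P i] as d. Subtracting d,
   composed with [res_map Q m], removes the failure and leaves the values of f on boundaries from Q
   unchanged. *)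
have [t tE] := splitP i.
have [d [dP dE]] : exists d : Q m -> P i -> X, equivariant_biadditive d /\
    forall q p, c p q = d q (res_map P i p).
  apply: (biadd_extend (@pQ m) tE (biadd_flip cP)) => q p.
  by move=> /res_exact[p' <-]; apply: c1.
have dP' := biadd_comp (res_map Q m) idfun dP.
exists (fun p q => f p q - d (res_map Q m q) p); split.
- split=> [p p' q|p q q'|g p q].
  + rewrite (biaddBl fP) (biaddBr dP') /=.
    by rewrite !opprD addrACA.
  + rewrite (biaddBr fP) (biaddBl dP') /=.
    by rewrite !opprD addrACA.
  + by rewrite (biadd_equiv fP) (biadd_equiv dP') scalerBr.
- by move=> p q; rewrite -dE -cE subrr.
- by move=> p q; rewrite res_map_comp (biadd0 _ (biadd_flip dP)) subr0 fE.
Qed.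

End DoubleComplex.

(** The hypothesis says that Ext^(n+1)(N, X) = 0 for all X. Shifting reduces to n = 0, where the
    universal cocycle [shift_aug Q] extends to a retraction of Q 0 onto the first syzygy, so that N
    is a direct summand of Q 0. *)
Lemma res_rdim_lift (N : lmodType R) (Q : resolution N) n :
  res_all (@projective _) Q ->
  (forall (X : lmodType R) (f : {linear Q n.+1 -> X}),
    (forall x, f (res_map Q n.+1 x) = 0) ->
    exists g : {linear Q n -> X}, forall x, g (res_map Q n x) = f x) ->
  rdim (@projective _) n N.
Proof.
elim: n N Q => [|n IHn] N Q pQ lift; last first.
  exists (kermod (res_aug Q)), (Q 0), (ker_incl _), (res_aug Q).
  split; [exact/ker_ses/res_aug_surj | exact: pQ |].
  by apply: (IHn _ (shift Q)) => [j|]; [exact: pQ | exact: lift].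
have [x|g gE] := lift _ (shift_aug Q).
  apply: (@ker_incl_inj _ _ _ (res_aug Q)).
  by rewrite shift_augE res_map_comp linear0.
have gK x : res_aug Q x = 0 -> ker_incl (res_aug Q) (g x) = x.
  by move=> /res_exact0[y <-]; rewrite gE shift_augE.
have [|s sE] := @linear_factor R (Q 0) N (Q 0) (res_aug Q)
    (idfun \- (ker_incl (res_aug Q) \o g)) (@res_aug_surj _ _ Q).
  by move=> x x0; rewrite -[LHS]/(x - ker_incl _ (g x)) gK // subrr.
apply: (@projective_retract R N (Q 0) s (res_aug Q) _ (pQ 0)) => y.
have [x <-] := res_aug_surj Q y; rewrite sE linearB /=.
by rewrite -[RHS]subr0; congr (_ - _); apply/(@ker_inclP _ _ _ (res_aug Q)); exists (g x).
Qed.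

Lemma trivial_gelt g (z : trivial_module G) : gelt g *: z = z.
Proof. by rewrite -[LHS]/(augmentation _ * _) augmentationU mul1r. Qed.

(* pd (N tensor Z) <= pd Z, for N free over Z with the diagonal action. *)
Theorem rdim_zfree_embeddable (N : lmodType R) (P : resolution (trivial_module G)) n :
  res_all (@projective _) P -> res_length_le P n -> zfree_embeddable N ->
  rdim (@projective _) n N.
Proof.
move=> pP lenP zN; have [Q pQ] := projective_resolution N.
apply: (res_rdim_lift pQ) => X f f0.
have fz x : res_map Q n x = 0 -> f x = 0.
  by move=> /res_exact[y <-].
(* The cocycle f is pulled back along the augmentation of P, which starts the induction in column
   0. *)
have [//|//||p q|p q /fz|c [cP c1 cE]] := biadd_coboundary pP pQ zfree_embeddable_trivial
    zN lenP (X := X) (k := n) (i := 0) (m := n)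
    (b := fun p q => f q *~ (res_aug P p : int)).
- split=> [p p' q|p q q'|g p q].
  + by rewrite linearB mulrzBr.
  + by rewrite linearB mulrzBl.
  + by rewrite !linearZ /= trivial_gelt -scalerMzr.
- by rewrite res_aug_comp mulr0z.
- by move=> ->; rewrite mul0rz.
(* Evaluating c at an element of augmentation 1 recovers f. The result commutes with G since p1 - g
   p1 is a boundary, where c vanishes. *)
have [p1 p1E] := res_aug_surj P (1 : int).
have [|g q|h hE] := @gr_linear (Q n) X (c p1).
- exact: (biaddBr cP).
- rewrite -(biadd_equiv cP); apply/eqP; rewrite -subr_eq0 -(biaddBl cP).
  have /res_exact0[p <-] : res_aug P (p1 - gelt g *: p1) = 0.
    by rewrite linearB linearZ /= trivial_gelt subrr.
  by rewrite c1.
by exists h => x; rewrite hE -cE p1E mulr1z.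
Qed.

End GroupRingModules.

(** * Reduction modulo a central regular element *)

Definition restr (R S : nzRingType) (pi : {rmorphism R -> S}) (N : lmodType S) : Type := N.

Section Restriction.
Variables (R S : nzRingType) (pi : {rmorphism R -> S}).

HB.instance Definition _ (N : lmodType S) := GRing.Zmodule.on (restr pi N).

Section Instance.
Variable N : lmodType S.

Definition restr_scale (r : R) (u : restr pi N) : restr pi N := pi r *: (u : N).

Fact restr_scaleA a b u : restr_scale a (restr_scale b u) = restr_scale (a * b) u.
Proof. by rewrite /restr_scale scalerA rmorphM. Qed.

Fact restr_scale1 : left_id 1 restr_scale.
Proof. by move=> u; rewrite /restr_scale rmorph1 scale1r. Qed.

Fact restr_scaleDr : right_distributive restr_scale +%R.
Proof. by move=> a u v; exact: (scalerDr (pi a) (u : N) v). Qed.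

Fact restr_scaleDl u : {morph restr_scale^~ u : a b / a + b}.
Proof. by move=> a b; rewrite /restr_scale rmorphD scalerDl. Qed.

HB.instance Definition _ := GRing.Zmodule_isLmodule.Build R (restr pi N)
  restr_scaleA restr_scale1 restr_scaleDr restr_scaleDl.

Lemma restrZ r (u : restr pi N) : r *: u = pi r *: (u : N).
Proof. by []. Qed.

End Instance.

Lemma restr_linear (M N : lmodType S) (f : {linear M -> N}) :
  exists g : {linear restr pi M -> restr pi N}, forall u, g u = f u.
Proof.
by apply: (@linear_pack R (restr pi M) (restr pi N) f) => a u v; exact: (linearP f).
Qed.

Lemma restr_ses (K P N : lmodType S) (i : {linear K -> P}) (p : {linear P -> N}) :
  ses i p -> exists (j : {linear restr pi K -> restr pi P})
    (q : {linear restr pi P -> restr pi N}), ses j q.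
Proof.
move=> [inj_i pS ex]; have [j jE] := restr_linear i; have [q qE] := restr_linear p.
exists j, q; split=> [u v|y|u].
- by rewrite !jE => /inj_i.
- by have [u <-] := pS y; exists u.
by rewrite qE; split=> [/ex[k <-]|[k <-]]; [exists k | apply/ex; exists k].
Qed.

Lemma restr_fin_generated (N : lmodType S) :
  fin_generated (restr pi N : lmodType R) -> fin_generated N.
Proof.
move=> [n [e eP]]; exists n, e => u; have [a aE] := eP u.
exists (map_mx pi a); rewrite [LHS]aE.
by apply: eq_bigr => i _; rewrite mxE.
Qed.

Hypothesis pi_surj : onto pi.

Lemma fin_generated_restr (N : lmodType S) :
  fin_generated N -> fin_generated (restr pi N : lmodType R).
Proof.
move=> [n [e eP]]; have [s sE] := choice pi_surj.
exists n, e => u; have [a aE] := eP u.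
exists (map_mx s a); rewrite [LHS]aE.
by apply: eq_bigr => i _; rewrite restrZ mxE sE.
Qed.

End Restriction.

(** * Two-periodic resolutions *)

Section Periodic.
Variables (R : nzRingType) (M0 M1 N : lmodType R).
Variables (a : {linear M1 -> M0}) (b : {linear M0 -> M1}) (e : {linear M0 -> N}).
Hypothesis e_onto : onto e.
Hypothesis ker_e : forall u, e u = 0 <-> exists v, a v = u.
Hypothesis ker_a : forall v, a v = 0 <-> exists u, b u = v.
Hypothesis ker_b : forall u, b u = 0 <-> exists v, a v = u.

(** Recursion in steps of two makes degrees j and j.+2 convertible, so periodicity holds by
    reflexivity. *)
Fixpoint periodic_mod (j : nat) : lmodType R :=
  match j with 0 => M0 | 1 => M1 | j'.+2 => periodic_mod j' end.

Fixpoint periodic_map (j : nat) : {linear periodic_mod j.+1 -> periodic_mod j} :=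
  match j with 0 => a | 1 => b | j'.+2 => periodic_map j' end.

Fact periodic_exact j u :
  periodic_map j u = 0 <-> exists v, periodic_map j.+1 v = u.
Proof.
suff [] : (forall u, periodic_map j u = 0 <-> exists v, periodic_map j.+1 v = u) /\
  (forall u, periodic_map j.+1 u = 0 <-> exists v, periodic_map j.+2 v = u) by [].
by elim: j {u} => [|j [IHj IHj1]]; split.
Qed.

Lemma periodic_resolution : exists F : resolution N,
  two_periodic_from F 0 /\ forall q, q M0 -> q M1 -> res_all q F.
Proof.
exists (Resolution e_onto ker_e periodic_exact); split=> [//|q q0 q1 j].
suff [] : q (periodic_mod j) /\ q (periodic_mod j.+1) by [].
by elim: j => [|j []].
Qed.

End Periodic.

Lemma splice_periodic (R : nzRingType) (K P N : lmodType R) (i : {linear K -> P})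
    (p : {linear P -> N}) (ip : ses i p) (F : resolution K) d :
  two_periodic_from F d -> two_periodic_from (splice ip F) d.+1.
Proof. by case=> F1 F2; split=> -[//|j]; rewrite ltnS; [apply: F1 | apply: F2]. Qed.

Lemma splice_all (R : nzRingType) (K P N : lmodType R) (i : {linear K -> P})
    (p : {linear P -> N}) (ip : ses i p) (F : resolution K) (q : lmodType R -> Prop) :
  q P -> res_all q F -> res_all q (splice ip F).
Proof. by move=> qP qF [|j]; [exact: qP | exact: qF]. Qed.

(** * Base change to the quotient ring *)

Section QuotientRing.
Variables (R S : nzRingType) (pi : {rmorphism R -> S}) (x : R).
Hypothesis pi_surj : onto pi.
Hypothesis x_central : forall r, x * r = r * x.
Hypothesis x_regular : forall r, x * r = 0 -> r = 0.
Hypothesis pi_ker : forall r, pi r = 0 <-> exists s, x * s = r.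

Implicit Types (P Q : lmodType R) (M N : lmodType S).

Lemma pi_x : pi x = 0.
Proof. by apply/pi_ker; exists 1; rewrite mulr1. Qed.

Lemma mulx_linear P : exists f : {linear P -> P}, forall u, f u = x *: u.
Proof.
by apply: linear_pack => a u v; rewrite scalerDr !scalerA x_central.
Qed.

Lemma scalex_inj P (u : P) : projective P -> x *: u = 0 -> u = 0.
Proof.
move=> pP xu; have [s sE] := pP _ _ (counit P) idfun (counit_surj (N := P)).
have su : x *: s u = 0 by rewrite -linearZ xu linear0.
rewrite -[u]/(idfun u) -sE; suff -> : s u = 0 by rewrite linear0.
apply/malgP => k; rewrite mcoeff0; apply: x_regular.
by rewrite -mcoeffZ su mcoeff0.
Qed.

Section Reduction.
Variable P : lmodType R.

Definition multx : {pred P} := [pred u | `[< exists w, u = x *: w >]].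

Fact multx_zmod_closed : zmod_closed multx.
Proof.
split=> [|u v /asboolP[w ->] /asboolP[w' ->]]; apply/asboolP.
  by exists 0; rewrite scaler0.
by exists (w - w'); rewrite scalerBr.
Qed.

HB.instance Definition _ := GRing.isZmodClosed.Build P multx multx_zmod_closed.

(** The quotient P / xP, which is the base change of P to S. The scalar s acts through any preimage
    under pi, well defined because ker pi = xR. *)
Definition reduction : Type := Quotient.quot multx.
HB.instance Definition _ := GRing.Zmodule.on reduction.

Definition red (u : P) : reduction := \pi_(Quotient.quot multx) u.

Lemma red_eq u v : red u = red v <-> exists w, u - v = x *: w.
Proof.
split=> [/eqP|uv]; first by rewrite -Quotient.idealrBE => /asboolP.
by apply/eqP; rewrite -Quotient.idealrBE; apply/asboolP.
Qed.

Lemma red_onto (u : reduction) : exists v, red v = u.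
Proof. by exists (repr u); rewrite /red reprK. Qed.

Lemma redD u v : red (u + v) = red u + red v.
Proof. by rewrite /red !piE. Qed.

Definition red_repr (u : reduction) : P := sval (cid (red_onto u)).

Lemma red_reprK u : red (red_repr u) = u.
Proof. exact: svalP (cid (red_onto u)). Qed.

Definition pi_section (s : S) : R := sval (cid (pi_surj s)).

Lemma pi_sectionK s : pi (pi_section s) = s.
Proof. exact: svalP (cid (pi_surj s)). Qed.

Definition red_scale (s : S) (u : reduction) : reduction :=
  red (pi_section s *: red_repr u).

Lemma red_scaleE r u : red_scale (pi r) (red u) = red (r *: u).
Proof.
apply/red_eq; set s := pi_section _; set v := red_repr _.
have /red_eq[w wE] : red v = red u by exact: red_reprK.
have /pi_ker[t tE] : pi (s - r) = 0 by rewrite rmorphB pi_sectionK subrr.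
exists (t *: v + r *: w); rewrite scalerDr !scalerA tE x_central -scalerA -wE.
by rewrite scalerBl scalerBr addrA subrK.
Qed.

Fact red_scaleA a b u : red_scale a (red_scale b u) = red_scale (a * b) u.
Proof.
rewrite -[u]red_reprK -[a]pi_sectionK -[b]pi_sectionK -rmorphM.
by rewrite !red_scaleE scalerA.
Qed.

Fact red_scale1 : left_id 1 red_scale.
Proof. by move=> u; rewrite -[u]red_reprK -(rmorph1 pi) red_scaleE scale1r. Qed.

Fact red_scaleDr : right_distributive red_scale +%R.
Proof.
move=> a u v; rewrite -[u]red_reprK -[v]red_reprK -[a]pi_sectionK -redD.
by rewrite !red_scaleE scalerDr redD.
Qed.

Fact red_scaleDl u : {morph red_scale^~ u : a b / a + b}.
Proof.
move=> a b; rewrite -[u]red_reprK -[a]pi_sectionK -[b]pi_sectionK -rmorphD.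
by rewrite !red_scaleE scalerDl redD.
Qed.

HB.instance Definition _ := GRing.Zmodule_isLmodule.Build S reduction
  red_scaleA red_scale1 red_scaleDr red_scaleDl.

Lemma redZ r u : pi r *: red u = red (r *: u).
Proof. exact: red_scaleE. Qed.

Lemma red_eq0 u : red u = 0 <-> exists w, u = x *: w.
Proof.
have <- : red 0 = 0 by rewrite /red piE.
by rewrite red_eq subr0.
Qed.

Lemma red_linear : exists f : {linear P -> restr pi reduction}, forall u, f u = red u.
Proof. by apply: linear_pack => a u v; rewrite redD restrZ redZ. Qed.

(** The adjunction between base change and restriction: x acts as zero on [restr pi N]. *)
Lemma red_factor N (f : {linear P -> restr pi N}) :
  exists g : {linear reduction -> N}, forall u, g (red u) = f u.
Proof.
have eq_f u v : red u = red v -> f u = f v.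
  move=> /red_eq[w wE]; apply/eqP; rewrite -subr_eq0 -linearB wE linearZ /=.
  by rewrite restrZ pi_x scale0r.
have [|g gE] := @linear_pack S reduction N (fun u => f (red_repr u)).
  move=> a u v; rewrite -[a in RHS]pi_sectionK -restrZ.
  rewrite -[RHS](linearP f); apply: eq_f.
  by rewrite redD -redZ pi_sectionK !red_reprK.
by exists g => u; rewrite gE; apply: eq_f; rewrite red_reprK.
Qed.

Lemma red_projective : projective P -> projective reduction.
Proof.
move=> pP M N g f gS; have [g' g'E] := restr_linear pi g.
have [f' f'E] := restr_linear pi f; have [r rE] := red_linear.
have [|h hE] := pP _ _ g' (f' \o r); first by move=> y; have [z <-] := gS y; exists z.
have [k kE] := red_factor h; exists k => u; rewrite -[u]red_reprK kE.
by rewrite -[LHS]g'E hE /= f'E rE.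
Qed.

Lemma red_fin_generated : fin_generated P -> fin_generated reduction.
Proof.
move=> [n [e eP]]; exists n, (red \o e) => u; have [a aE] := eP (red_repr u).
exists (map_mx pi a); rewrite -[u]red_reprK aE.
have [r rE] := red_linear; rewrite -rE linear_sum.
by apply: eq_bigr => i _; rewrite linearZ /= restrZ rE mxE.
Qed.

Lemma red_fg_projective : fg_projective P -> fg_projective reduction.
Proof. by move=> [fP pP]; split; [exact: red_fin_generated | exact: red_projective]. Qed.

Lemma red_fg_free : fg_free P -> fg_free reduction.
Proof.
move=> [n [e eP]]; exists n, (red \o e) => u.
have redE (a : 'rV[R]_n) : red (\sum_i a 0 i *: e i) =
    \sum_i map_mx pi a 0 i *: red (e i).
  have [r rE] := red_linear; rewrite -rE linear_sum.
  by apply: eq_bigr => i _; rewrite linearZ /= restrZ rE mxE.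
have [a [aE _]] := eP (red_repr u); exists (map_mx pi a); split.
  by rewrite -[u]red_reprK aE redE.
move=> b bE; pose b' := map_mx pi_section b.
have b'E : map_mx pi b' = b by apply/rowP => i; rewrite !mxE pi_sectionK.
have /red_eq[w wE] : red (red_repr u) = red (\sum_i b' 0 i *: e i).
  by rewrite red_reprK redE b'E.
have [d [dE _]] := eP w.
have [d' [_ d'U]] := eP (\sum_i (a - b') 0 i *: e i).
(* Two coordinate vectors of u in the reduction have lifts that differ by coordinates of a multiple
   of x; by uniqueness of coordinates in P the difference is x times a vector. *)
have ab : a - b' = x *: d.
  rewrite -[LHS](d'U _ erefl); apply: d'U; move: wE.
  rewrite [red_repr u]aE -sumrB dE scaler_sumr.
  under eq_bigr => i _ do rewrite -scalerBl.
  under [RHS]eq_bigr => i _ do rewrite scalerA.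
  move=> wE; transitivity (\sum_i (a 0 i - b' 0 i) *: e i).
    by apply: eq_bigr => i _; rewrite !mxE.
  by rewrite wE; apply: eq_bigr => i _; rewrite !mxE.
apply/rowP => i; rewrite -b'E !mxE; apply/eqP; rewrite -subr_eq0 -rmorphB.
have := congr1 (fun v : 'rV_n => v 0 i) ab; rewrite !mxE => ->.
by rewrite rmorphM pi_x mul0r.
Qed.

End Reduction.

Lemma red_map P Q (f : {linear P -> Q}) :
  exists g : {linear reduction P -> reduction Q}, forall u, g (red u) = red (f u).
Proof.
have [r rE] := red_linear Q; have [g gE] := red_factor (r \o f).
by exists g => u; rewrite gE /= rE.
Qed.

(* Eisenbud's matrix factorization: x kills N, so multiplication by x on P0
   factors as i \o b, and reducing the pair (i, b) modulo x resolves N. *)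
Lemma matrix_factorization N P0 P1 (i : {linear P1 -> P0}) (p : {linear P0 -> restr pi N}) :
  ses i p -> (forall u : P0, x *: u = 0 -> u = 0) ->
  exists F : resolution N, two_periodic_from F 0 /\
    forall q : lmodType S -> Prop, q (reduction P0) -> q (reduction P1) -> res_all q F.
Proof.
move=> [inj_i pS ex] reg; have [m mE] := mulx_linear P0.
have [|b bE] := @linear_lift R P0 P1 P0 i m inj_i.
  by move=> u; apply/ex; rewrite mE linearZ /= restrZ pi_x scale0r.
have ib u : i (b u) = x *: u by rewrite bE mE.
have iZ v : i (x *: v) = x *: i v by rewrite linearZ.
have bi v : b (i v) = x *: v by apply: inj_i; rewrite ib iZ.
have [A AE] := red_map i; have [B BE] := red_map b; have [e eE] := red_factor p.
apply: (@periodic_resolution S (reduction P0) (reduction P1) N A B e).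
- by move=> y; have [u <-] := pS y; exists (red u).
- move=> u; have [u' <-] := red_onto u; rewrite eE.
  split=> [/ex[v <-]|[v]]; first by exists (red v).
  have [v' <-] := red_onto v; rewrite AE => /red_eq[w wE].
  apply/ex; exists (v' - b w); rewrite linearB ib -wE.
  by rewrite opprB addrC subrK.
- move=> v; have [v' <-] := red_onto v; rewrite AE red_eq0.
  split=> [[w wE]|[u]].
    by exists (red w); rewrite BE; congr red; apply: inj_i; rewrite ib.
  have [u' <-] := red_onto u; rewrite BE => /red_eq[w wE].
  exists (u' - i w); rewrite scalerBr -iZ -wE -ib -linearB.
  by rewrite opprB addrC subrK.
move=> u; have [u' <-] := red_onto u; rewrite BE red_eq0.
split=> [[w wE]|[v]].
  exists (red w); rewrite AE; congr red; apply/eqP; rewrite -subr_eq0; apply/eqP/reg.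
  by rewrite scalerBr -iZ -ib wE subrr.
have [v' <-] := red_onto v; rewrite AE => /red_eq[w wE].
exists (v' - b w); apply: inj_i; rewrite ib iZ linearB ib -wE.
by rewrite opprB [i v' + _]addrC subrK.
Qed.

Lemma rdim_restr_row (p : lmodType R -> Prop) k :
  p 'rV[R]_k -> rdim p 1 (restr pi 'rV[S]_k : lmodType R).
Proof.
move=> pR; have [m mE] := mulx_linear 'rV[R]_k.
have [|f fE] := @linear_pack R 'rV[R]_k (restr pi 'rV[S]_k) (map_mx pi).
  by move=> a u v; rewrite map_mxD map_mxZ restrZ.
exists 'rV[R]_k, 'rV[R]_k, m, f; split=> //; split=> [u v|v|u].
- rewrite !mE => /eqP; rewrite -subr_eq0 -scalerBr => /eqP uv.
  by apply/eqP; rewrite -subr_eq0 (scalex_inj (@projective_row _ _) uv).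
- exists (map_mx pi_section (v : 'rV[S]_k)); rewrite fE.
  by apply/rowP => i; rewrite !mxE pi_sectionK.
rewrite fE; split=> [u0|[v <-]]; last first.
  by rewrite mE; apply/rowP => i; rewrite !mxE rmorphM pi_x mul0r.
have /choice[g gE] : forall i, exists r, x * r = u 0 i.
  move=> i; apply/pi_ker; have := congr1 (fun v : 'rV[S]_k => v 0 i) u0.
  by rewrite !mxE.
by exists (\row_i g i); rewrite mE; apply/rowP => i; rewrite !mxE gE.
Qed.

(** An idempotent matrix over S need not lift to R, so N need not be the reduction of a projective
    R-module. Instead N and a complement C in a free module S^n are both covered by P; the kernel of
    the product cover is finitely generated projective, because S^n has dimension 1, and the kernel
    of P -> N is a factor of it. *)
Lemma rdim_restr_fg_projective N :
  fg_projective N -> rdim (@fg_projective R) 1 (restr pi N : lmodType R).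
Proof.
move=> [/fin_generatedP[n [f fS]] pN]; have [i iE] := pN _ _ f idfun fS.
have [g [h [gK hK]]] := iso_trans (split_iso (ker_ses fS) iE) (iso_prodC _ _).
set C := kermod f in g h gK hK.
have fgR : fg_projective 'rV[R]_n by apply/fg_free_projective/fg_free_row.
have [K [P [j [m [jm pP _]]]]] := rdim_restr_row fgR.
have [_ mS _] := jm.
have [g1 g1E] : exists g1 : {linear P -> restr pi N}, forall u, g1 u = (g (m u)).1.
  by apply: linear_pack => a u v; rewrite linearP [g _]linearP.
have [g2 g2E] : exists g2 : {linear P -> restr pi C}, forall u, g2 u = (g (m u)).2.
  by apply: linear_pack => a u v; rewrite linearP [g _]linearP.
have g1S : onto g1.
  by move=> y; have [u uE] := mS (h (y, 0)); exists u; rewrite g1E uE hK.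
have g2S : onto g2.
  by move=> y; have [u uE] := mS (h (0, y)); exists u; rewrite g2E uE hK.
have [l [q lq]] := ses_prod (ker_ses g1S) (ker_ses g2S).
have [|G GE] := @linear_pack R (restr pi 'rV[S]_n) (restr pi N * restr pi C)%type g.
  by move=> a u v; rewrite [LHS](linearP g).
have isoG : iso (restr pi 'rV[S]_n) (restr pi N * restr pi C)%type.
  apply: (iso_bij (f := G)) => [u v|y].
    by rewrite !GE => /(can_inj gK).
  by exists (h y); rewrite GE hK.
have goodR := good_fg_projective R.
have := rdim_cover goodR lq (good_prod goodR pP pP)
  (rdim_iso goodR isoG (rdim_restr_row fgR)).
move=> [/fin_generated_fst fL /projective_fst pL].
by exists (kermod g1), P, (ker_incl g1), g1; split=> //; exact: ker_ses.
Qed.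

Theorem eventually_periodic_projective d M (F : resolution M) :
  res_all (@fg_projective S) F ->
  rdim (@projective R) d.+1 (restr pi M : lmodType R) ->
  exists F' : resolution M, res_all (@fg_projective S) F' /\ two_periodic_from F' d.
Proof.
elim: d M F => [|d IHd] M F pF rM; last first.
  have ip := ker_ses (@res_aug_surj _ _ F).
  have [i [p ip']] := restr_ses pi ip.
  have r1 : rdim (@projective R) 1 (restr pi (F 0) : lmodType R).
    have [K [P [j [q [jq [_ pP] [_ pK]]]]]] := rdim_restr_fg_projective (pF 0).
    by exists K, P, j, q.
  have rK := rdim_syzygy (good_projectives R) ip' r1 rM.
  have [F' [pF' F'd]] := IHd _ (shift F) (fun j => pF j.+1) rK.
  by exists (splice ip F'); split; [exact: splice_all | exact: splice_periodic].
have [L [Q [l [q [lq pQ pL]]]]] := rdim_restr_fg_projective (pF 0).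
have [i [p ip]] := restr_ses pi (ker_ses (@res_aug_surj _ _ F)).
have [_ qS _] := lq; have [_ pS _] := ip.
have pqS : onto (p \o q).
  by move=> y; have [u <-] := pS y; have [v <-] := qS u; exists v.
have kerpq := ker_ses pqS.
have pK := rdim_cover (good_projectives R) kerpq (proj2 pQ) rM.
have [k [t kt]] := ses_compr lq ip kerpq.
(* The dimension bound gives projectivity of this kernel only. It is finitely generated as an
   extension of the first syzygy of M over S, an image of F 1, by L. *)
have fK : fin_generated (kermod (p \o q)).
  apply: fin_generated_ext kt (proj1 pL) _; apply: fin_generated_restr => //.
  exact: (fin_generated_surj (@shift_aug_surj _ _ F) (proj1 (pF 1))).
have [|F' [F'd F'q]] := matrix_factorization kerpq.
  by move=> u; apply: scalex_inj; case: pQ.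
by exists F'; split=> //; apply: F'q; apply: red_fg_projective.
Qed.

Theorem eventually_periodic_free d M :
  rdim (@stably_free R) d.+1 (restr pi M : lmodType R) ->
  exists F : resolution M, res_all (@fg_free S) F /\ two_periodic_from F d.
Proof.
have goodR := good_stably_free R.
elim: d M => [|d IHd] M rM; last first.
  have /fin_generatedP[n [f fS]] : fin_generated M.
    apply: (restr_fin_generated (pi := pi)); case: rM => [K [P [i [p [[_ pS _] pP _]]]]].
    exact: fin_generated_surj pS (stably_free_fg pP).
  have ip := ker_ses fS; have [i [p ip']] := restr_ses pi ip.
  have r1 := rdim_restr_row (fg_free_stably_free (@fg_free_row R n)).
  have rK := rdim_syzygy goodR ip' r1 rM.
  have [F [pF Fd]] := IHd _ rK.
  exists (splice ip F); split; last exact: splice_periodic.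
  by apply: splice_all => //; exact: fg_free_row.
have [K [P [i [p [ip [F1 [fF1 fPF1]] [F2 [fF2 fKF2]]]]]]] := rM.
have pP : projective P by apply: (good_projective goodR); exists F1.
(* Adding F to P and to the kernel K makes both free: F1 complements P and F2 complements K. *)
set F := (F1 * F2)%type.
have fF : fg_free F by exact: fg_free_prod.
have [j [r [jr rE]]] := ses_fst P F.
have [_ rS _] := jr; have [_ pS _] := ip.
have prS : onto (p \o r).
  by move=> y; have [u <-] := pS y; have [v <-] := rS u; exists v.
have [k [t kt]] := ses_compr jr ip (ker_ses prS).
have pK : projective K by apply: (good_projective goodR); exists F2.
have [_ tS _] := kt; have [s sE] := pK _ _ t idfun tS.
have fPF : fg_free (P * F)%type.
  by apply: fg_free_iso (iso_sym (iso_prodA _ _ _)) _; apply: fg_free_prod.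
have fker : fg_free (kermod (p \o r)).
  apply: fg_free_iso (iso_sym (split_iso kt sE)) _.
  apply: fg_free_iso _ (fg_free_prod fF1 fKF2).
  exact: iso_trans (iso_prod (iso_refl _) (iso_prodC _ _)) (iso_prodA _ _ _).
have [|F' [F'd F'q]] := matrix_factorization (ker_ses prS).
  by move=> u; apply: scalex_inj; have [] := fg_free_projective fPF.
by exists F'; split=> //; apply: F'q; apply: red_fg_free.
Qed.

End QuotientRing.

(** * The group ring of a central quotient *)

Section DimensionComparison.
Variables (R : nzRingType) (p : lmodType R -> Prop).
Hypothesis gp : good p.
Implicit Types N : lmodType R.

Lemma resolution_rdim N (F : resolution N) n :
  res_all p F -> res_length_le F n -> rdim p n N.
Proof.
elim: n N F => [|n IHn] N F pF lenF; last first.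
  exists (kermod (res_aug F)), (F 0), (ker_incl _), (res_aug F).
  split; [exact/ker_ses/res_aug_surj | exact: pF |].
  by apply: (IHn _ (shift F)) => [j|j nj]; [exact: pF | exact: (lenF j.+1)].
apply: (good_iso gp) (pF 0); apply: (iso_bij (f := res_aug F)); last exact: res_aug_surj.
move=> u v /eqP; rewrite -subr_eq0 -linearB => /eqP/res_exact0[y].
by rewrite (lenF 1 isT y) linear0 => /esym/eqP; rewrite subr_eq0 => /eqP.
Qed.

Lemma rdim_of_projective m N : rdim p m N -> projective N -> p N.
Proof.
elim: m N => [//|m IHm] N [K [P [i [q [iq pP rK]]]]] pN.
have [_ qS _] := iq; have [s sE] := pN _ _ q idfun qS.
have PKN := split_iso iq sE.
have pK : projective K.
  exact: projective_fst (projective_iso PKN (good_projective gp pP)).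
apply: (good_cancel gp (V := K)); last exact: IHm.
exact: (good_iso gp) (iso_trans PKN (iso_prodC _ _)) pP.
Qed.

(** The n-th kernel is projective, so the rest of the resolution splits and cancellation puts that
    kernel in p. For stably free modules this shortens a finite free resolution to the length given
    by the projective dimension. *)
Lemma rdim_of_projective_dim m n N : rdim p m N -> rdim (@projective R) n N -> rdim p n N.
Proof.
elim: n m N => [|n IHn] m N; first exact: rdim_of_projective.
case: m => [pN _|m [K [P [i [q [iq pP rK]]]]] rN].
  exact: (rdim_leq gp (leq0n _) (pN : rdim p 0 N)).
exists K, P, i, q; split=> //; apply: IHn rK _.
exact: (rdim_cover (d := n) (good_projectives R) iq (good_projective gp pP) rN).
Qed.

End DimensionComparison.

Section GroupRingQuotient.
Variables (G : groupType) (N : normal_subgroup G).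
Local Notation Gamma := (quotg N).
Local Notation R := (groupring G).
Local Notation S := (groupring Gamma).

Lemma additive_gelt (V : zmodType) (H : groupType) (h : H -> V) :
  exists f : {additive groupring H -> V}, forall x, f (gelt x) = h x.
Proof.
have /choice[s sE] : forall x, exists s : {additive int -> V}, forall a, s a = h x *~ a.
  by move=> x; apply: additive_pack => a b; rewrite mulrzBr.
have [|f fE] := @additive_pack (groupring H) V (malg_lift s).
  by move=> a b; exact: (raddfB (malg_lift s)).
by exists f => x; rewrite fE [LHS](malg_liftU s) sE.
Qed.

Definition qmap (g : G) : Gamma := \pi_(quotg N) g.

Lemma qmapM g h : qmap (g * h)%g = (qmap g * qmap h)%g.
Proof. by rewrite [RHS](pi_quotg_mul N g h). Qed.

Lemma qmap_exists : exists pi : {rmorphism R -> S}, forall g, pi (gelt g) = gelt (qmap g).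
Proof.
have [f fE] := additive_gelt (fun g => gelt (qmap g)).
have f1 : f 1 = 1 by rewrite -[1 in LHS]gelt1 fE.
have fM : {morph f : a b / a * b}.
  move=> a b.
  have [u uE] : exists u : {additive R -> S}, forall a, u a = f (a * b).
    by apply: additive_pack => ? ?; rewrite mulrBl raddfB.
  have [v vE] : exists v : {additive R -> S}, forall a, v a = f a * f b.
    by apply: additive_pack => ? ?; rewrite raddfB mulrBl.
  rewrite -uE -vE; apply: gr_additive_ext => g; rewrite uE vE.
  have [u' u'E] : exists u : {additive R -> S}, forall b, u b = f (gelt g * b).
    by apply: additive_pack => ? ?; rewrite mulrBr raddfB.
  have [v' v'E] : exists v : {additive R -> S}, forall b, v b = f (gelt g) * f b.
    by apply: additive_pack => ? ?; rewrite raddfB mulrBr.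
  rewrite -u'E -v'E; apply: gr_additive_ext => h; rewrite u'E v'E.
  by rewrite -geltM !fE qmapM geltM.
pose m := GRing.isMonoidMorphism.Build R S f (f1, fM).
pose pi : {rmorphism R -> S} := HB.pack (Algebra.Additive.sort f) m f.
by exists pi.
Qed.

Lemma qmap_surj (pi : {rmorphism R -> S}) :
  (forall g, pi (gelt g) = gelt (qmap g)) -> onto pi.
Proof.
move=> piE s; rewrite (gr_sum s).
exists (\sum_(u <- msupp s) gelt (repr u) *~ s@_u); rewrite rmorph_sum.
by apply: eq_bigr => u _; rewrite raddfMz /= piE /qmap reprK.
Qed.

Lemma augmentation_qmap (pi : {rmorphism R -> S}) r :
  (forall g, pi (gelt g) = gelt (qmap g)) -> augmentation (pi r) = augmentation r.
Proof.
move=> piE.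
have [e eE] : exists e : {additive R -> int}, forall r, e r = augmentation r.
  apply: additive_pack => a b; apply/eqP; rewrite eq_sym subr_eq -augmentationD.
  by rewrite subrK.
have [e' e'E] : exists e : {additive R -> int}, forall r, e r = augmentation (pi r).
  apply: additive_pack => a b; apply/eqP; rewrite eq_sym subr_eq -augmentationD.
  by rewrite rmorphB subrK.
rewrite -eE -e'E; apply: gr_additive_ext => g; rewrite eE e'E piE.
by rewrite !augmentationU.
Qed.

Lemma restr_trivial (pi : {rmorphism R -> S}) :
  (forall g, pi (gelt g) = gelt (qmap g)) ->
  iso (trivial_module G : lmodType R) (restr pi (trivial_module Gamma)).
Proof.
move=> piE.
have [|f fE] := @linear_pack R (trivial_module G)
    (restr pi (trivial_module Gamma)) (fun z => z).
  move=> a u v; congr (_ + _); rewrite [RHS]/(augmentation _ * _) augmentation_qmap //.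
by apply: (iso_bij (f := f)) => [u v|u]; [rewrite !fE | exists u; rewrite fE].
Qed.

End GroupRingQuotient.

(** * The element c - 1 of the group ring *)

Section CentralElement.
Variables (G : groupType) (c : G).
Hypothesis cZ : c \in center G.
Local Notation R := (groupring G).
Local Notation x := (gelt c - 1 : R).

Lemma center_commute g : (c * g = g * c)%g.
Proof. by have /asboolP/(_ g) := cZ. Qed.

Lemma gelt_central r : gelt c * r = r * gelt c.
Proof.
have [u uE] : exists u : {additive R -> R}, forall r, u r = gelt c * r.
  by apply: additive_pack => ? ?; rewrite mulrBr.
have [v vE] : exists v : {additive R -> R}, forall r, v r = r * gelt c.
  by apply: additive_pack => ? ?; rewrite mulrBl.
rewrite -uE -vE; apply: gr_additive_ext => g.
by rewrite uE vE -!geltM center_commute.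
Qed.

Lemma geltB1_central r : x * r = r * x.
Proof. by rewrite mulrBl mulrBr gelt_central mul1r mulr1. Qed.

Lemma gelt_mcoeff h g (r : R) : (gelt h * r)@_(h * g)%g = r@_g.
Proof.
have [u uE] : exists u : {additive R -> int}, forall r, u r = (gelt h * r)@_(h * g)%g.
  by apply: additive_pack => a b; rewrite mulrBr mcoeffB.
have [v vE] : exists v : {additive R -> int}, forall r, v r = r@_g.
  by apply: additive_pack => a b; rewrite mcoeffB.
rewrite -uE -vE; apply: gr_additive_ext => k.
by rewrite uE vE -geltM !mcoeffU (inj_eq (mulgI h)).
Qed.

(** If x r = 0, the coefficients of r are constant along multiplication by c. A nonempty support
    would then contain infinitely many translates of one element; one more than its size already
    contradicts finiteness. *)
Lemma geltB1_regular : (forall n, (0 < n)%N -> (c ^+ n)%g <> 1%g) ->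
  forall r, x * r = 0 -> r = 0.
Proof.
move=> c_inf r /eqP; rewrite mulrBl mul1r subr_eq0 => /eqP cr.
apply: (proj1 (@malgP G int r 0)) => g; rewrite mcoeff0.
apply/eqP/negPn/negP; rewrite mcoeff_neq0 => rg.
pose s := [seq (c ^+ n * g)%g | n <- iota 0 (size (msupp r)).+1].
have rs h : h \in s -> h \in msupp r.
  case/mapP => n _ ->; elim: n => [|n IHn]; first by rewrite mul1g.
  by rewrite -mcoeff_neq0 expgS -mulgA -cr gelt_mcoeff mcoeff_neq0.
have uniq_s : uniq s.
  rewrite map_inj_uniq ?iota_uniq // => a b /mulIg.
  wlog le_ab : a b / (a <= b)%N.
    by move=> th eq_ab; case: (leqP a b) => [/th|/ltnW/th/(_ (esym eq_ab))]; [exact|].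
  move=> eq_ab; have eq1 : (c ^+ (b - a) = 1)%g.
    by apply: (mulIg (c ^+ a)%g); rewrite -expgnDr subnK // mul1g.
  by apply/eqP; rewrite eqn_leq le_ab /= leqNgt -subn_gt0; apply/negP => /c_inf.
have := uniq_leq_size uniq_s rs.
by rewrite size_map size_iota ltnn.
Qed.

Lemma gelt_cycB1 g : g \in cyc c -> exists r, gelt g - 1 = x * r.
Proof.
have posE n : exists r, gelt (c ^+ n)%g - 1 = x * r.
  elim: n => [|n [r rE]]; first by exists 0; rewrite mulr0 gelt1 subrr.
  exists (gelt c * r + 1); rewrite expgS geltM mulrDr mulr1.
  by rewrite [x * _]mulrA geltB1_central -mulrA -rE mulrBr mulr1 addrA subrK.
move=> /asboolP[n [->|->]]; first exact: posE.
have [r rE] := posE n; exists (- (gelt (c ^- n)%g * r)).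
rewrite mulrN [x * _]mulrA geltB1_central -mulrA -rE mulrBr.
by rewrite -geltM mulVg mulr1 opprB.
Qed.

Lemma qmap_ker (pi : {rmorphism R -> groupring (central_quotient cZ)}) :
  (forall g, pi (gelt g) = gelt (qmap (central_cyc cZ) g)) ->
  forall r, pi r = 0 <-> exists s, x * s = r.
Proof.
move=> piE r; split=> [pir|[s <-]]; last first.
  rewrite rmorphM rmorphB piE rmorph1.
  suff -> : qmap (central_cyc cZ) c = 1%g by rewrite gelt1 subrr mul0r.
  apply/esym/coset_eqP; rewrite invg1 mul1g.
  by apply/asboolP; exists 1%N; left.
(* Replacing group elements by representatives of their cosets changes r by a multiple of x, and the
   outcome depends on [pi r] only. *)
have [s sE] := additive_gelt (fun u : central_quotient cZ => gelt (repr u : G)).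
suff [t tE] : exists t, r - s (pi r) = x * t.
  by exists t; rewrite -tE pir raddf0 subr0.
rewrite {pir} (gr_sum r) rmorph_sum !raddf_sum -big_split /=.
elim/big_rec: _ => [|g y _ [t ->]]; first by exists 0; rewrite mulr0.
rewrite !raddfMz /= piE sE; set h := repr _.
have [t' t'E] : exists t', gelt g - gelt h = x * t'.
  have [|u uE] := @gelt_cycB1 (h^-1 * g)%g.
    apply: (proj1 (coset_eqP (central_cyc cZ) h g)).
    by rewrite /h reprK.
  exists (gelt h * u); rewrite mulrA geltB1_central -mulrA -uE.
  by rewrite mulrBr mulr1 -geltM mulVKg.
exists (t' *~ r@_g + t); rewrite mulrDr; congr (_ + _).
by rewrite -mulrzDl t'E mulrzAr.
Qed.

End CentralElement.

(** * Tate cohomology of a finite central cyclic subgroup *)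

Section FiniteOrder.
Variables (G : groupType) (c : G) (m : nat).
Hypotheses (cZ : c \in center G) (m_gt1 : (1 < m)%N) (cm : (c ^+ m = 1)%g).
Hypothesis c_order : forall j, (0 < j < m)%N -> (c ^+ j)%g <> 1%g.
Local Notation R := (groupring G).
Local Notation x := (gelt c - 1 : R).
Implicit Types K N P : lmodType R.

Definition cyc_norm : R := \sum_(j < m) gelt (c ^+ j)%g.

Lemma cyc_norm_inv : \sum_(j < m) gelt (c ^- j)%g = cyc_norm * gelt c.
Proof.
rewrite (reindex_inj rev_ord_inj) mulr_suml; apply: eq_bigr => j _ /=.
rewrite -geltM -expgSr; congr gelt; apply: (mulgI (c ^+ (m - j.+1))%g).
by rewrite mulgV -expgnDr subnK.
Qed.

(* Vanishing of the Tate cohomology of <[c]> with coefficients in N. *)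
Definition tate_acyclic N : Prop :=
  (forall u : N, x *: u = 0 -> exists v, u = cyc_norm *: v) /\
  (forall u : N, cyc_norm *: u = 0 -> exists v, u = x *: v).

(** Higman's criterion: the identity is the trace over the powers of c of an additive endomorphism.
    Unlike the existence of a basis, this passes to direct summands. *)
Definition averaging N : Prop := exists t : {additive N -> N},
  forall u, \sum_(j < m) gelt (c ^- j)%g *: t (gelt (c ^+ j)%g *: u) = u.

Lemma averaging_acyclic N : averaging N -> tate_acyclic N.
Proof.
move=> [t tE]; split=> u u0.
  have cu : gelt c *: u = u.
    by apply/eqP; rewrite -subr_eq0 -[u in _ - u]scale1r -scalerBl u0.
  have cju j : gelt (c ^+ j)%g *: u = u.
    elim: j => [|j IHj]; first by rewrite gelt1 scale1r.
    by rewrite expgS geltM -scalerA IHj.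
  exists (gelt c *: t u); rewrite scalerA -cyc_norm_inv scaler_suml -[LHS]tE.
  by apply: eq_bigr => j _; rewrite cju.
(* Subtracting t ([cyc_norm] u) = 0 from the averaging formula replaces each c^-j by c^-j - 1, a
   multiple of x. *)
have /choice[r rE] : forall j : 'I_m, exists r, gelt (c ^- j)%g - 1 = x * r.
  move=> j; apply: (gelt_cycB1 cZ).
  by apply/asboolP; exists (nat_of_ord j); right.
exists (\sum_(j < m) r j *: t (gelt (c ^+ j)%g *: u)).
rewrite scaler_sumr -[LHS]tE.
under [RHS]eq_bigr => j _ do rewrite scalerA -rE scalerBl scale1r.
rewrite sumrB -raddf_sum -scaler_suml.
by rewrite -/cyc_norm u0 raddf0 subr0.
Qed.

Lemma averaging_retract N P (i : {linear N -> P}) (r : {linear P -> N}) :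
  cancel i r -> averaging P -> averaging N.
Proof.
move=> iK [t tE]; exists (r \o t \o i) => u; rewrite -[RHS]iK -[i u in RHS]tE.
by rewrite linear_sum; apply: eq_bigr => j _; rewrite linearZ /= linearZ.
Qed.

Lemma center_commuteX k g : (c ^+ k * g = g * c ^+ k)%g.
Proof. exact/esym/commuteX/esym/center_commute. Qed.

Lemma cyc_exponent g h : (h^-1 * g)%g \in cyc c ->
  exists2 j : 'I_m, g = (c ^+ j * h)%g & forall k : 'I_m, g = (c ^+ k * h)%g -> k = j.
Proof.
have c_mod e : (c ^+ e = c ^+ (e %% m))%g.
  by rewrite {1}(divn_eq e m) expgnDr mulnC expgnA cm expg1n mul1g.
have m_gt0 : (0 < m)%N by apply: ltnW.
move=> /cycP[a [b hg]].
have [e gE] : exists e, g = (c ^+ e * h)%g.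
  exists (a + b * m.-1)%N; rewrite center_commuteX -[g in LHS](mulVKg h) hg.
  congr (_ * _)%g.
  rewrite expgnDr; congr (_ * _)%g; apply: (mulgI (c ^+ b)%g).
  by rewrite mulgV -expgnDr -mulnS prednK // mulnC expgnA cm expg1n.
exists (Ordinal (ltn_pmod e m_gt0)) => [|k]; rewrite gE c_mod //= => /mulIg.
move: (e %% m)%N (ltn_pmod e m_gt0) => d d_m; case: k => k k_m /= dk.
apply: val_inj => /=; apply/eqP; rewrite eqn_leq; apply/andP.
have le (a' b' : nat) : (a' < m)%N -> (c ^+ a' = c ^+ b')%g -> (a' <= b')%N.
  move=> am ab; rewrite leqNgt; apply/negP => ba.
  case: (@c_order (a' - b')); first by rewrite subn_gt0 ba (leq_ltn_trans (leq_subr _ _)).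
  by apply: (mulIg (c ^+ b')%g); rewrite -expgnDr subnK 1?ltnW // mul1g.
by split; apply: le.
Qed.

(** The map t keeps only the coefficients at chosen coset representatives. Exactly one of the m
    translates of g is a representative, so a single term of the sum survives. *)
Lemma averaging_ring : exists t : {additive R -> R},
  forall r, \sum_(j < m) gelt (c ^- j)%g * t (gelt (c ^+ j)%g * r) = r.
Proof.
pose rep g : G := repr (qmap (central_cyc cZ) g).
have [t tE] := additive_gelt (fun g : G => if g == rep g then gelt g else 0 : R).
exists t => r.
have [u uE] : exists u : {additive R -> R},
    forall r, u r = \sum_(j < m) gelt (c ^- j)%g * t (gelt (c ^+ j)%g * r).
  apply: additive_pack => a b; rewrite -sumrB; apply: eq_bigr => j _.
  by rewrite mulrBr raddfB mulrBr.
rewrite -uE -[RHS]/(idfun r); apply: gr_additive_ext => g; rewrite uE /=.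
have rep_cyc h k : (h^-1 * k)%g \in cyc c -> rep h = rep k.
  by move=> hk; rewrite /rep; congr repr; exact/coset_eqP.
have repK g' : ((rep g')^-1 * g')%g \in cyc c.
  by apply: (proj1 (coset_eqP (central_cyc cZ) _ g')); rewrite /rep reprK.
have g_rep : (g^-1 * rep g)%g \in cyc c.
  by apply: (proj1 (coset_eqP (central_cyc cZ) g _)); rewrite /rep reprK.
have [j jE j_uniq] := cyc_exponent g_rep.
have rep_c k : rep (c ^+ k * g)%g = rep g.
  apply: rep_cyc; rewrite invgM -mulgA.
  have -> : ((c ^+ k)^-1 * g = g * (c ^+ k)^-1)%g.
    apply: (mulgI (c ^+ k)%g); rewrite mulVKg mulgA.
    by rewrite center_commuteX mulgK.
  by rewrite mulKg; apply/asboolP; exists k; right.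
rewrite (bigD1 j) //= big1 => [|k kj]; rewrite -geltM tE rep_c.
  by rewrite -jE eqxx addr0 jE -geltM mulKg.
case: eqP => [/esym /j_uniq kE|_]; last by rewrite mulr0.
by rewrite kE eqxx in kj.
Qed.

Lemma averaging_malg (K : choiceType) : averaging {malg R[K]}.
Proof.
have [t tE] := averaging_ring.
pose h k : {additive R -> {malg R[K]}} := mkmalgU k \o t.
exists (malg_lift h) => a.
have [u uE] : exists u : {additive {malg R[K]} -> {malg R[K]}}, forall a,
    u a = \sum_(j < m) gelt (c ^- j)%g *: malg_lift h (gelt (c ^+ j)%g *: a).
  apply: additive_pack => b b'; rewrite -sumrB; apply: eq_bigr => j _.
  by rewrite scalerBr raddfB scalerBr.
rewrite -uE [a]monalgE raddf_sum; apply: eq_bigr => k _; rewrite uE.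
have scaleU (b w : R) : b *: << w *g k >> = << b * w *g k >> :> {malg R[K]}.
  by rewrite malgU_scale scalerA -malgU_scale.
under eq_bigr => j _ do rewrite scaleU malg_liftU /= scaleU.
by rewrite -raddf_sum tE.
Qed.

Lemma averaging_projective N : projective N -> averaging N.
Proof.
move=> pN; have [s sK] := pN _ _ (counit N) idfun (counit_surj (N := N)).
exact: averaging_retract sK (averaging_malg _).
Qed.

Lemma cyc_norm_central r : cyc_norm * r = r * cyc_norm.
Proof.
rewrite mulr_suml mulr_sumr; apply: eq_bigr => j _.
elim: (nat_of_ord j) r => [|k IHk] r; first by rewrite gelt1 mul1r mulr1.
by rewrite expgS geltM -mulrA IHk mulrA (gelt_central cZ) -mulrA.
Qed.

(** This is the long exact sequence. By 2-periodicity of Tate cohomology, acyclicity of K in one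
    parity and of P in the other gives N, and the two parities together give both claims. *)
Lemma acyclic_quotient K P N (i : {linear K -> P}) (q : {linear P -> N}) :
  ses i q -> tate_acyclic K -> tate_acyclic P -> tate_acyclic N.
Proof.
move=> iq [Kx Kn] [Px Pn]; have [inj_i qS ex] := iq.
have norm_x : cyc_norm * x = 0.
  rewrite mulrBr mulr1; apply/eqP; rewrite subr_eq0; apply/eqP/(addrI (1 : R)).
  have <- : \sum_(j < m.+1) gelt (c ^+ j)%g = 1 + cyc_norm * gelt c.
    rewrite big_ord_recl mulr_suml; congr (_ + _).
    by apply: eq_bigr => j _; rewrite -geltM -expgSr.
  by rewrite big_ord_recr /= cm addrC.
have iZ r k : i (r *: k) = r *: i k by rewrite linearZ.
split=> u u0; have [p pu] := qS u.
  have /ex[k kE] : q (x *: p) = 0 by rewrite linearZ /= pu.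
  have [|k' k'E] := Kn k.
    by apply: inj_i; rewrite linear0 iZ kE scalerA norm_x scale0r.
  have [|w wE] := Px (p - i k'); first by rewrite scalerBr -kE -iZ -k'E subrr.
  exists (q w); rewrite -[in RHS]linearZ /= -wE linearB pu.
  by rewrite (ses_comp0 _ iq) subr0.
have /ex[k kE] : q (cyc_norm *: p) = 0 by rewrite linearZ /= pu.
have [|k' k'E] := Kx k.
  by apply: inj_i; rewrite linear0 iZ kE scalerA -cyc_norm_central norm_x scale0r.
have [|w wE] := Pn (p - i k'); first by rewrite scalerBr -kE -iZ -k'E subrr.
exists (q w); rewrite -[in RHS]linearZ /= -wE linearB pu.
by rewrite (ses_comp0 _ iq) subr0.
Qed.

Lemma rdim_acyclic n N : rdim (@projective R) n N -> tate_acyclic N.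
Proof.
elim: n N => [|n IHn] N; first by move=> /averaging_projective/averaging_acyclic.
move=> [K [P [i [q [iq pP /IHn aK]]]]].
exact: acyclic_quotient iq aK (averaging_acyclic (averaging_projective pP)).
Qed.

(** The Tate group in degree 0 is Z / m: the norm acts on Z as multiplication by m > 1, so it misses
    the invariant element 1. *)
Lemma trivial_not_acyclic : ~ tate_acyclic (trivial_module G).
Proof.
case=> /(_ (1 : int))[|v vE _].
  by rewrite scalerBl scale1r trivial_gelt subrr.
have : (1 : int) = v *+ m.
  rewrite [LHS]vE scaler_suml; under eq_bigr => j _ do rewrite trivial_gelt.
  by rewrite sumr_const card_ord.
rewrite -mulr_natr => /(congr1 absz); rewrite abszM natz /= => /esym/eqP.
by rewrite muln_eq1 [m == _]gtn_eqF ?andbF.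
Qed.

End FiniteOrder.

Lemma rdim_trivial_torsion_free (G : groupType) (c : G) n :
  c \in center G -> c <> 1%g ->
  rdim (@projective (groupring G)) n (trivial_module G) ->
  forall k, (0 < k)%N -> (c ^+ k)%g <> 1%g.
Proof.
move=> cZ c_neq1 rZ k k_gt0 ck.
have ex_k : exists k, (0 < k)%N && ((c ^+ k)%g == 1%g).
  by exists k; rewrite k_gt0 ck eqxx.
case: (ex_minnP ex_k) => m /andP[m_gt0 /eqP cm] m_min.
have m_gt1 : (1 < m)%N.
  by rewrite ltn_neqAle m_gt0 andbT; apply/eqP => m1; rewrite -m1 in cm.
apply: (@trivial_not_acyclic G c m m_gt1 _); apply: (rdim_acyclic cZ m_gt1 cm _ rZ).
move=> j /andP[j_gt0 j_m] cj.
by move: j_m; rewrite ltnNge m_min // j_gt0 cj eqxx.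
Qed.

Theorem theorem2 (G : groupType) (c : G) (cZ : c \in center G) :
  type_FP G -> c <> 1%g ->
  let Gamma := central_quotient cZ in
  type_VFP Gamma ->
  (forall M : lmodType (groupring Gamma), type_FPinfty M ->
     exists F : resolution M,
       res_all (@fg_projective _) F /\ eventually_two_periodic F) /\
  (type_FL G -> forall n : nat, cd_eq G n ->
     exists F : resolution (trivial_module Gamma),
       res_all (@fg_free _) F /\ two_periodic_from F n.-1).
Proof.
move=> [P [n [fpP lenP]]] c_neq1 Gamma _.
have pP : res_all (@projective _) P by move=> j; case: (fpP j).
have rZ := resolution_rdim (good_projectives _) pP lenP.
have c_inf := rdim_trivial_torsion_free cZ c_neq1 rZ.
have [pi piE] := qmap_exists (central_cyc cZ).
have pi_surj := qmap_surj piE.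
have x_central := geltB1_central cZ.
have x_regular := geltB1_regular c_inf.
have pi_ker := qmap_ker piE.
split=> [M [F pF]|[Q [m [fQ lenQ]]] d [[Q' [pQ' lenQ']] _]].
  set K := kermod (res_aug F).
  have zK : zfree_embeddable (restr pi K).
    apply: (@zfree_embeddable_inj K (F 0) (ker_incl (res_aug F))).
      exact: ker_incl_inj.
    by apply: zfree_embeddable_projective; case: (pF 0).
  (* The bound is raised from n to n.+1 because the periodicity theorem takes a positive
     dimension. *)
  have rK := rdimS (good_projectives _) (rdim_zfree_embeddable pP lenP zK).
  have [F' [pF' F'n]] := eventually_periodic_projective pi_surj x_central
    x_regular pi_ker (F := shift F) (fun j => pF j.+1) rK.
  have ip := ker_ses (@res_aug_surj _ _ F).
  exists (splice ip F'); split; first exact: splice_all.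
  by exists n.+1; exact: splice_periodic.
have goodR := good_stably_free (groupring G).
have rQ : rdim (@stably_free _) m (trivial_module G).
  by apply: resolution_rdim lenQ => // j; apply: fg_free_stably_free.
have rQ' := resolution_rdim (good_projectives _) pQ' lenQ'.
have rd := rdim_of_projective_dim goodR rQ rQ'.
apply: (eventually_periodic_free pi_surj x_central x_regular pi_ker).
apply: (rdim_iso goodR (restr_trivial piE)).
(* The bound d.-1.+1 equals d unless d = 0, where it is 1. *)
by apply: rdim_leq rd => //; case: (d).
Qed.
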